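(* Let $H$ be a separable Hilbert space, $D$ a closed symmetric operator in $H$ with deficiency indices $(1,1)$, $X$ a locally compact Hausdorff space and $\Lambda:X\to S^1$ a Borel function. Let $T_\Lambda$ be the associated closed semiregular operator in the Hilbert $C^*$-module $C_0(X,H)$ over $C_0(X)$ defined in the context. Then: (1) $T_\Lambda$ is regular if and only if $(\mathrm{ssupp}(\Lambda))^\circ=\mathrm{ssupp}(\Lambda)$. (2) $T_\Lambda$ is selfadjoint if and only if $\mathrm{ssupp}(\Lambda)=\mathrm{ssupp}_r(\Lambda)$. (3) $T_\Lambda$ is selfadjoint and regular if and only if $\Lambda$ is continuous (i.e. $\mathrm{ssupp}(\Lambda)=\emptyset$). (4) $T_\Lambda^*$ is selfadjoint and regular if and only if $\tilde\Lambda$ is continuous on $X$ (i.e. $\mathrm{ssupp}(\Lambda)=\mathrm{reg}_\infty(\Lambda)$).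
   Context: Put $D_{\min}=D$, $D_{\max}=D^*$, and equip $\mathrm{dom}(D_{\max})$ with the graph inner product $\langle\xi,\eta\rangle_D=\langle\xi,\eta\rangle+\langle D_{\max}\xi,D_{\max}\eta\rangle$. Let $\phi_\pm\in\mathrm{dom}(D_{\max})$ be vectors, normalized in the graph norm, with $D_{\max}\phi_\pm=\pm i\phi_\pm$, so that $\mathrm{dom}(D_{\max})=\mathrm{dom}(D_{\min})\oplus\mathbb{C}\phi_+\oplus\mathbb{C}\phi_-$ orthogonally for the graph inner product. Put $\alpha_\pm(\xi)=\langle\phi_\pm,\xi\rangle_D$. $E=C_0(X,H)$ is the Hilbert $C^*$-module over $C_0(X)$ with $\langle f,g\rangle(x)=\langle f(x),g(x)\rangle_H$. Let $\mathrm{dom}(T_{\max})=C_0(X,\mathrm{dom}(D_{\max}))$ and $(T_{\max}f)(x)=D_{\max}(f(x))$. $T_\Lambda$ is the restriction of $T_{\max}$ to $\mathrm{dom}(T_\Lambda)=\{f\in\mathrm{dom}(T_{\max}):\alpha_+\circ f=\Lambda\cdot(\alpha_-\circ f)\}$. $\mathrm{reg}(\Lambda)=\{p\in X:\Lambda\text{ is continuous in a neighborhood of }p\}$, $\mathrm{ssupp}(\Lambda)=X\setminus\mathrm{reg}(\Lambda)$. For $p\in\partial\,\mathrm{reg}(\Lambda)=\partial\,\mathrm{ssupp}(\Lambda)$, $p\in\mathrm{reg}_\infty(\Lambda)$ means that there are an open neighborhood $U$ of $p$ and a continuous $\tilde\Lambda:U\to S^1$ agreeing with $\Lambda$ on $U\cap\mathrm{reg}(\Lambda)$;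 the value $\tilde\Lambda(p)=\lim_{q\to p,\,q\in\mathrm{reg}(\Lambda)}\Lambda(q)$ is then uniquely determined. Put $\tilde\Lambda=\Lambda$ on $\mathrm{reg}(\Lambda)$, so $\tilde\Lambda$ is defined on $\mathrm{reg}(\Lambda)\cup\mathrm{reg}_\infty(\Lambda)$ (in (4), ''$\tilde\Lambda$ is continuous on $X$'' means in particular that $\tilde\Lambda$ is defined on all of $X$, as made precise by the parenthetical condition). $\mathrm{ssupp}_r(\Lambda)=\partial\,\mathrm{ssupp}(\Lambda)\setminus\mathrm{reg}_\infty(\Lambda)$. $(\cdot)^\circ$ denotes the interior. A semiregular operator in a Hilbert $C^*$-module is an operator $T$ with domain a dense submodule whose adjoint $T^*$ is densely defined, where $y\in\mathrm{dom}(T^* )$ iff there is $z=T^*y$ with $\langle Tx,y\rangle=\langle x,z\rangle$ for all $x\in\mathrm{dom}(T)$. A closed semiregular $T$ is regular if $I+T^*T$ has dense range (it is then invertible); $T$ is selfadjoint if $T=T^*$. *)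

(* Defs.v *)
(* The complex numbers are R[i] over a realType R; R[i]^o is R[i] with its norm
   topology. *)
From HB Require Import structures.
From mathcomp Require Import all_boot all_order all_algebra.
From mathcomp Require Import complex.
From mathcomp Require Import all_classical all_reals all_analysis.
Set Implicit Arguments.
Unset Strict Implicit.
Unset Printing Implicit Defensive.
Import Order.TTheory GRing.Theory Num.Theory numFieldNormedType.Exports.
Local Open Scope classical_set_scope.
Local Open Scope ring_scope.

(* The values of [opfun] outside [dom] are junk: operators are compared with
   [op_eq], never with Leibniz equality. *)
Record operator (V : Type) := Operator { dom : set V ; opfun :> V -> V }.

Definition op_eq (V : Type) (S T : operator V) : Prop :=
  dom S = dom T /\ forall x, dom T x -> S x = T x.

Definition linear_operator (K : nzRingType) (V : lmodType K)
    (T : operator V) : Prop :=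
  dom T 0 /\ forall (a : K) x y, dom T x -> dom T y ->
    dom T (a *: x + y) /\ T (a *: x + y) = a *: T x + T y.

Definition closed_operator (V : topologicalType) (T : operator V) : Prop :=
  closed [set (x, T x) | x in dom T].

(* The adjoint with respect to a B-valued inner product on E `<=` V; it is used
   both for a Hilbert space and for a Hilbert C*-module.  The vector z = T^* y
   is unique as soon as dom T is dense in E. *)
Section Adjoint.
Context (V : zmodType) (B : Type) (E : set V) (ip : V -> V -> B).

Definition adjoint_values (T : operator V) (y : V) : set V :=
  [set z | E z /\ forall x, dom T x -> ip (T x) y = ip x z].

Definition adjoint (T : operator V) : operator V :=
  Operator [set y | E y /\ adjoint_values T y !=set0]
           (fun y => xget 0 (adjoint_values T y)).

End Adjoint.

Definition separable (T : topologicalType) : Prop :=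
  exists2 A : set T, countable A & dense A.

Definition has_dim (K : nzRingType) (V : lmodType K) (W : set V) (n : nat) :
    Prop :=
  exists e : 'I_n -> V,
    W = [set \sum_(i < n) c i *: e i | c in [set: 'I_n -> K]] /\
    forall c : 'I_n -> K,
      \sum_(i < n) c i *: e i = 0 -> forall i, c i = 0.

Section HilbertSpace.
Context (R : realType) (H : completeNormedModType R[i])
  (dot : {dot H for Num.conj}).

(* The forms of sesquilinear.v are linear in their first argument; the inner
   products here are linear in the second one, as for Hilbert C*-modules. *)
Definition ip (x y : H) : R[i] := dot y x.

Definition hadjoint : operator H -> operator H := adjoint setT ip.

Definition closed_symmetric (D : operator H) : Prop :=
  [/\ linear_operator D, dense (dom D), closed_operator D &
      forall x y, dom D x -> dom D y -> ip (D x) y = ip x (D y)].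

Definition deficiency_space (D : operator H) (z : R[i]) : set H :=
  [set xi | dom (hadjoint D) xi /\ hadjoint D xi = z *: xi].

Definition deficiency_indices (D : operator H) (n m : nat) : Prop :=
  has_dim (deficiency_space D 'i) n /\ has_dim (deficiency_space D (- 'i)) m.

Definition graph_ip (D : operator H) (xi eta : H) : R[i] :=
  ip xi eta + ip (D xi) (D eta).

Definition graph_norm (D : operator H) (xi : H) : R[i] :=
  sqrtC (graph_ip D xi xi).

End HilbertSpace.

(* C_0(X, W) for W `<=` V a vector space with norm N.  The norm is a parameter
   because C_0(X, dom D_max) refers to the graph norm; for N = Num.norm the
   first clause is continuity in the usual sense. *)
Definition C0 (K : numFieldType) (X : topologicalType) (V : zmodType)
    (W : set V) (N : V -> K) (f : X -> V) : Prop :=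
  [/\ forall x, W (f x),
      forall p (e : K), 0 < e -> \forall q \near p, N (f q - f p) < e &
      forall e : K, 0 < e ->
        exists2 A : set X, compact A & forall x, ~ A x -> N (f x) < e].

(* C_0(X, H) is viewed as a subset of {uniform X -> H}, whose topology induces
   on it that of the norm |<f, f>|^(1/2) = sup_x |f x|. *)
Section HilbertModule.
Context (R : realType) (H : completeNormedModType R[i])
  (dot : {dot H for Num.conj}) (X : topologicalType).

Definition module : set {uniform X -> H} :=
  [set f | C0 setT (fun v : H => `|v|) f].

Definition module_ip (f g : {uniform X -> H}) : X -> R[i] :=
  fun x => ip dot (f x) (g x).

Definition module_act (a : X -> R[i]) (f : {uniform X -> H}) :
    {uniform X -> H} := fun x => a x *: f x.

Definition madjoint : operator {uniform X -> H} -> operator {uniform X -> H} :=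
  adjoint module module_ip.

(* As module is closed in {uniform X -> H}, the closedness of a subset of
   module `*` module can be tested in the ambient product. *)
Definition mdense (A : set {uniform X -> H}) : Prop := module `<=` closure A.

Definition module_operator (T : operator {uniform X -> H}) : Prop :=
  [/\ dom T `<=` module, forall f, dom T f -> module (T f),
      linear_operator T &
      forall a f, C0 setT (fun z : R[i] => `|z|) a -> dom T f ->
        dom T (module_act a f) /\ T (module_act a f) = module_act a (T f)].

Definition semiregular (T : operator {uniform X -> H}) : Prop :=
  [/\ module_operator T, mdense (dom T) & mdense (dom (madjoint T))].

Definition regular (T : operator {uniform X -> H}) : Prop :=
  [/\ closed_operator T, semiregular T &
      mdense [set f + madjoint T (T f) |
                f in [set f | dom T f /\ dom (madjoint T) (T f)]]].

Definition selfadjoint (T : operator {uniform X -> H}) : Prop :=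
  semiregular T /\ op_eq T (madjoint T).

Definition Tmax (D : operator H) : operator {uniform X -> H} :=
  let Dmax := hadjoint dot D in
  Operator [set f : {uniform X -> H} | C0 (dom Dmax) (graph_norm dot Dmax) f]
           (fun f x => Dmax (f x)).

Definition TLambda (D : operator H) (phip phim : H) (Lambda : X -> R[i]^o) :
    operator {uniform X -> H} :=
  let alpha phi := graph_ip dot (hadjoint dot D) phi in
  Operator [set f | dom (Tmax D) f /\
                    forall x, alpha phip (f x) = Lambda x * alpha phim (f x)]
           (Tmax D).

End HilbertModule.

Section SingularSupport.
Context (R : realType) (X : topologicalType).

(* measurableType requires a point, which X need not have; hence the Borel
   sets are used directly. *)
Definition borel (f : X -> R[i]^o) : Prop :=
  forall B, <<s @open R[i]^o >> B -> <<s @open X >> (f @^-1` B).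

Definition boundary (A : set X) : set X := closure A `\` A°.

Context (Lambda : X -> R[i]^o).

Definition reg : set X :=
  [set p | exists2 U, open_nbhs p U & {within U, continuous Lambda}].

Definition ssupp : set X := ~` reg.

(* The function L plays its role only on U. *)
Definition reg_oo : set X :=
  [set p | boundary reg p /\
    exists U (L : X -> R[i]^o),
      [/\ open_nbhs p U, {within U, continuous L},
          forall q, U q -> `|L q| = 1 &
          forall q, U q -> reg q -> L q = Lambda q]].

Definition ssupp_r : set X := boundary ssupp `\` reg_oo.

(* Meaningful on reg `|` reg_oo only. *)
Definition Lambda_tilde (p : X) : R[i]^o :=
  if p \in reg then Lambda p else lim (Lambda @ within reg (nbhs p)).

End SingularSupport.

(* Main.v *)
From mathcomp Require Import all_boot all_order all_algebra.
From mathcomp Require Import complex ring lra.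
From mathcomp Require Import all_classical all_reals all_analysis.
Require Import Defs.
Set Implicit Arguments.
Unset Strict Implicit.
Unset Printing Implicit Defensive.
Import Order.TTheory GRing.Theory Num.Theory numFieldNormedType.Exports.
Local Open Scope classical_set_scope.
Local Open Scope ring_scope.

(** Write alpha_+ and alpha_- (here alp and alm) for the two boundary values of an
   element of the domain of the adjoint D^*. The whole proof rests on Green's formula
   [boundary_form]: <D^* x, y> - <x, D^* y> equals -i times
   conj (alpha_+ x) alpha_+ y - conj (alpha_- x) alpha_- y. It follows from the
   von Neumann decomposition of the domain of D^* , which [von_neumann] gets from
   the orthogonal projection on the closed graph of D; the same projection
   gives the bounded operator (1 + D^* D)^-1, called [resolvent].

   In the module everything is pointwise in x. Testing with functions supported
   near a point shows that the domain of the adjoint of T_Lambda consists of the g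
   in dom Tmax such that alpha_+ g = Lambda (alpha_- g) on reg ([T_adj_dom]).
   On the other hand an f in dom T_Lambda has alpha_+ f = alpha_- f = 0 on ssupp
   ([T_ssupp]), since Lambda is continuous where alpha_- f does not vanish.

   (1) Let y be in the domain of D, with D y in the domain of D^* , and let
   h = y + D^* D y. Then alpha_+ (D y) = -i <phi_+, h> and
   alpha_- (D y) = i <phi_-, h>. If p is in the closure of reg but not in reg, this
   applies to y = f p for f in the domain of T^* T; as T f has boundary values of equal
   absolute value at p, so have <phi_+, h> and <phi_-, h>, and the range of
   1 + T^* T is not dense ([T_regular_ssupp]). If ssupp is clopen, a correction
   of (1 + D^* D)^-1 by eigenvectors solves f + T^* T f = g explicitly
   ([ssupp_T_range]).

   (2) T_Lambda and its adjoint differ exactly by functions with nonzero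
   boundary values on ssupp. Such functions exist near interior points of
   ssupp, and near points of reg_oo, where they are built from the continuous
   extension of Lambda. Conversely, if reg is dense and alpha_- f does not vanish at p,
   then alpha_+ f / alpha_- f is such an extension ([quotient_reg_oo]).

   (3) is the combination of (1) and (2). For (4), if ssupp = reg_oo then the
   adjoint of T_Lambda is the operator of the continuous function Lambda_tilde
   ([T_adj_tilde]); the converse combines the arguments for (1) and (2)
   ([adjoint_reg_oo]).

   Density of the domains: (1 + s^2 D^* D)^-1 tends to 1 strongly as s tends to
   0, hence uniformly on compact sets ([C0_domD_dense]). *)

(** * Real norms and inner products *)

Section RealNorm.
Context (R : realType).

(** The norm as an element of R: the order of R is total, that of R[i] is not. *)
Definition nr (V : normedZmodType R[i]) (x : V) : R := complex.Re `|x|.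

Context (V : normedZmodType R[i]).
Implicit Types x y : V.

Lemma nrE x : `|x| = ((nr x)%:C)%C.
Proof. by rewrite /nr RRe_real// normr_real. Qed.

Lemma nr_ge0 x : 0 <= nr x.
Proof. by rewrite -lecR -nrE normr_ge0. Qed.

Lemma nr_eq0 x : nr x = 0 -> x = 0.
Proof. by move=> h; apply/normr0_eq0; rewrite nrE h. Qed.

Lemma nr0 : nr (0 : V) = 0.
Proof. by rewrite /nr normr0. Qed.

Lemma nrD x y : nr (x + y) <= nr x + nr y.
Proof. by rewrite -lecR rmorphD/= -!nrE ler_normD. Qed.

Lemma nrN x : nr (- x) = nr x.
Proof. by rewrite /nr normrN. Qed.

Lemma nrB x y : nr (x - y) <= nr x + nr y.
Proof. by rewrite -(nrN y) nrD. Qed.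

Lemma nrBC x y : nr (x - y) = nr (y - x).
Proof. by rewrite -nrN opprB. Qed.

Lemma norm_lt x (e : R) : (`|x| < (e%:C)%C) = (nr x < e).
Proof. by rewrite nrE ltcR. Qed.

Lemma nr_eqE x (r : R) : `|x| = (r%:C)%C -> nr x = r.
Proof. by rewrite /nr => ->. Qed.

End RealNorm.

Section RealNormScalar.
Context (R : realType).

(** Positive elements of R[i] are real, so estimates can be made in R. *)
Lemma posC (e : R[i]) : 0 < e -> exists2 r : R, 0 < r & e = (r%:C)%C.
Proof.
move=> e0; exists (complex.Re e); last by rewrite RRe_real// gtr0_real.
by rewrite -ltcR RRe_real// gtr0_real.
Qed.

Lemma nrZ (V : normedModType R[i]) (a : R[i]) (x : V) :
  nr (a *: x) = nr a * nr x.
Proof. by apply: complexI; rewrite rmorphM/= -!nrE normrZ. Qed.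

Lemma nrM (a b : R[i]) : nr (a * b) = nr a * nr b.
Proof. by apply: complexI; rewrite rmorphM/= -!nrE normrM. Qed.

Lemma nrR (r : R) : nr ((r%:C)%C : R[i]) = `|r|.
Proof.
apply: nr_eqE; have [r0|r0] := leP 0 r.
  by rewrite ger0_norm ?ler0c// ger0_norm.
rewrite ltr0_norm; first by rewrite ltr0_norm// rmorphN.
by rewrite -[0]/((0:R)%:C)%C ltcR.
Qed.

Lemma nr_i : nr ('i : R[i]) = 1.
Proof. by apply: nr_eqE; rewrite normCi. Qed.

Lemma nr_conj (a : R[i]) : nr (a^* ) = nr a.
Proof. by apply: nr_eqE; rewrite norm_conjC nrE. Qed.

End RealNormScalar.

Section InnerProduct.
Context (R : realType) (H : completeNormedModType R[i])
  (dot : {dot H for Num.conj}) (norm_dot : forall x, `|x| ^+ 2 = dot x x).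
Local Notation ip := (ip dot).
Implicit Types x y z : H.

Lemma ipDr x y z : ip x (y + z) = ip x y + ip x z.
Proof. by rewrite /Defs.ip linearDl. Qed.

Lemma ipDl x y z : ip (x + y) z = ip x z + ip y z.
Proof. by rewrite /Defs.ip linearDr. Qed.

Lemma ipZr a x y : ip x (a *: y) = a * ip x y.
Proof. by rewrite /Defs.ip linearZl_LR. Qed.

Lemma ipZl a x y : ip (a *: x) y = a^* * ip x y.
Proof. by rewrite /Defs.ip linearZr_LR. Qed.

Lemma ipC x y : ip x y = (ip y x)^*.
Proof. by rewrite /Defs.ip hermC mul1r. Qed.

Lemma ipNr x y : ip x (- y) = - ip x y.
Proof. by rewrite -scaleN1r ipZr mulN1r. Qed.

Lemma ipNl x y : ip (- x) y = - ip x y.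
Proof. by rewrite ipC ipNr rmorphN/= -ipC. Qed.

Lemma ipBr x y z : ip x (y - z) = ip x y - ip x z.
Proof. by rewrite ipDr ipNr. Qed.

Lemma ipBl x y z : ip (x - y) z = ip x z - ip y z.
Proof. by rewrite ipDl ipNl. Qed.

Lemma ip0r x : ip x 0 = 0.
Proof. by rewrite -(scale0r (0 : H)) ipZr mul0r. Qed.

Lemma ip0l x : ip 0 x = 0.
Proof. by rewrite ipC ip0r rmorph0. Qed.

Lemma ip_nr x : ip x x = (((nr x) ^+ 2)%:C)%C.
Proof. by rewrite /Defs.ip -norm_dot nrE rmorphXn. Qed.

Definition rip x y : R := complex.Re (ip x y).

Lemma rip_nr x : rip x x = nr x ^+ 2.
Proof. by rewrite /rip ip_nr. Qed.

Lemma ripC x y : rip x y = rip y x.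
Proof. by rewrite /rip ipC; case: (ip y x). Qed.

Lemma ReD (a b : R[i]) : complex.Re (a + b) = complex.Re a + complex.Re b.
Proof. by case: a => ? ?; case: b. Qed.

Lemma ripDr x y z : rip x (y + z) = rip x y + rip x z.
Proof. by rewrite /rip ipDr ReD. Qed.

Lemma ripDl x y z : rip (x + y) z = rip x z + rip y z.
Proof. by rewrite ripC ripDr !(ripC z). Qed.

Lemma ripZr (t : R) x y : rip x ((t%:C)%C *: y) = t * rip x y.
Proof. by rewrite /rip ipZr; case: (ip x y) => a b /=; ring. Qed.

Lemma ripZl (t : R) x y : rip ((t%:C)%C *: x) y = t * rip x y.
Proof. by rewrite ripC ripZr ripC. Qed.

Lemma ripNr x y : rip x (- y) = - rip x y.
Proof. by rewrite /rip ipNr; case: (ip x y). Qed.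

Lemma ripNl x y : rip (- x) y = - rip x y.
Proof. by rewrite ripC ripNr ripC. Qed.

Lemma nrD_sqr x y : nr (x + y) ^+ 2 = nr x ^+ 2 + nr y ^+ 2 + 2 * rip x y.
Proof.
by rewrite -!rip_nr !(ripDl, ripDr) (ripC y x); ring.
Qed.

Lemma nrB_sqr x y : nr (x - y) ^+ 2 = nr x ^+ 2 + nr y ^+ 2 - 2 * rip x y.
Proof. by rewrite nrD_sqr nrN ripNr; ring. Qed.

Lemma nrZR (t : R) x : nr ((t%:C)%C *: x) ^+ 2 = t ^+ 2 * nr x ^+ 2.
Proof. by rewrite -!rip_nr ripZl ripZr; ring. Qed.

(** Expand the square of the norm of |y| x - |x| y. *)
Lemma rip_le x y : rip x y <= nr x * nr y.
Proof.
have [x0|x0] := eqVneq (nr x) 0.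
  by rewrite (nr_eq0 x0) /rip ip0l nr0 mul0r.
have [y0|y0] := eqVneq (nr y) 0.
  by rewrite (nr_eq0 y0) /rip ip0r nr0 mulr0.
have xp : 0 < nr x by rewrite lt_def x0 nr_ge0.
have yp : 0 < nr y by rewrite lt_def y0 nr_ge0.
have := sqr_ge0 (nr (((nr y)%:C)%C *: x - ((nr x)%:C)%C *: y)).
rewrite nrB_sqr !nrZR ripZl ripZr => h.
have : 0 <= 2 * (nr x * nr y) * (nr x * nr y - rip x y).
  by apply: le_trans h _; rewrite le_eqVlt; apply/orP; left; apply/eqP; ring.
by rewrite pmulr_rge0 ?subr_ge0// !mulr_gt0.
Qed.

(** Reduces to the real inner product by rotating y until ip x y is positive. *)
Lemma cauchy_schwarz x y : nr (ip x y) <= nr x * nr y.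
Proof.
have [z0|z0] := eqVneq (ip x y) 0.
  by rewrite z0 nr0 mulr_ge0 ?nr_ge0.
have nz : `|ip x y| != 0 by rewrite normr_eq0.
have := rip_le x ((`|ip x y| / ip x y) *: y).
rewrite /rip ipZr divfK// nrZ.
have -> : nr (`|ip x y| / ip x y) = 1.
  by apply: nr_eqE; rewrite normrM normfV normr_id divff.
by rewrite mul1r.
Qed.

End InnerProduct.

(** * Closed operators in a Hilbert space *)

Section Operators.
Context (R : realType) (H : completeNormedModType R[i])
  (dot : {dot H for Num.conj}) (norm_dot : forall x, `|x| ^+ 2 = dot x x).
Local Notation ip := (ip dot).
Local Notation rip := (rip dot).
Implicit Types x y z : H.

Lemma cauchy_seq_cvg (u : nat -> H) :
  (forall e : R, 0 < e ->
    exists N, forall m n, (N <= m)%N -> (N <= n)%N -> nr (u m - u n) < e) ->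
  exists l, forall e : R, 0 < e -> \forall n \near \oo, nr (u n - l) < e.
Proof.
move=> uC.
have cu : cauchy (u @ \oo).
  apply/cauchy_ballP => _ /posC[e e0 ->].
  have [N hN] := uC _ e0.
  exists (u @` [set n | (N <= n)%N], u @` [set n | (N <= n)%N]).
    by split; exists N => // n /= Nn; exists n.
  by move=> [_ _] [/= [m Nm <-] [n Nn <-]]; rewrite -ball_normE/= norm_lt; exact: hN.
have /cvg_ex[l ul] : cvg (u @ \oo) by exact: cauchy_cvg cu.
exists l => e e0.
move/cvgrPdist_lt : ul => /(_ (e%:C)%C).
rewrite -[0 < _]/(((0:R)%:C)%C < _) ltcR => /(_ e0).
by apply: filterS => n; rewrite norm_lt nrBC.
Qed.

Lemma closed_operatorP (T : operator H) x y : closed_operator T ->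
  (forall e : R, 0 < e ->
    exists z, [/\ dom T z, nr (z - x) < e & nr (T z - y) < e]) ->
  dom T x /\ T x = y.
Proof.
move=> clT h.
suff [z Tz [<- <-]] : [set (z, T z) | z in dom T] (x, y) by [].
apply: clT => B; rewrite nbhs_ballP => -[_ /posC[e e0 ->] /= eB].
have [z [Tz zx zy]] := h e e0.
exists (z, T z); split; first by exists z.
by apply: eB; split; rewrite /= -ball_normE/= norm_lt nrBC.
Qed.

Lemma closed_operator_of (T : operator H) :
  (forall x y, (forall e : R, 0 < e ->
    exists z, [/\ dom T z, nr (z - x) < e & nr (T z - y) < e]) ->
  dom T x /\ T x = y) -> closed_operator T.
Proof.
move=> h [x y] xy; suff [Tx <-] : dom T x /\ T x = y by exists x.
apply: h => e e0.
have [|_ [[z Tz <-]] [/= zx zy]] := xy [set p | nr (p.1 - x) < e /\ nr (p.2 - y) < e].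
  rewrite nbhs_ballP; exists (e%:C)%C => /=.
    by rewrite -[0]/(((0:R)%:C)%C) ltcR.
  by move=> [a b] [/=]; rewrite -!ball_normE/= !norm_lt nrBC (nrBC y).
by exists z.
Qed.

Lemma dense_nr (A : set H) : dense A ->
  forall x (e : R), 0 < e -> exists2 z, A z & nr (z - x) < e.
Proof.
move=> dA x e e0.
have e0' : 0 < (e%:C)%C by rewrite -[0]/(((0:R)%:C)%C) ltcR.
have [||z [xz Az]] := dA (ball x (e%:C)%C).
- by exists x; exact: ballxx.
- exact: ball_open.
- by exists z => //; move: xz; rewrite -ball_normE/= norm_lt nrBC.
Qed.

Context (D : operator H).
Context (Dlin : linear_operator D) (Dclosed : closed_operator D).

Lemma linear_domD x y : dom D x -> dom D y ->
  dom D (x + y) /\ D (x + y) = D x + D y.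
Proof. by move=> Dx Dy; have := Dlin.2 1 x y Dx Dy; rewrite !scale1r. Qed.

Lemma linear_op0 : D 0 = 0.
Proof.
have [_ ] := Dlin.2 1 0 0 Dlin.1 Dlin.1.
by rewrite !scale1r addr0 => /eqP; rewrite -subr_eq0 opprD addNKr oppr_eq0 => /eqP.
Qed.

Lemma linear_domZ a x : dom D x -> dom D (a *: x) /\ D (a *: x) = a *: D x.
Proof.
by move=> Dx; have := Dlin.2 a x 0 Dx Dlin.1; rewrite !addr0 linear_op0 addr0.
Qed.

Lemma linear_domB x y : dom D x -> dom D y ->
  dom D (x - y) /\ D (x - y) = D x - D y.
Proof.
move=> Dx Dy; have [N1 N2] := linear_domZ (-1) Dy.
by rewrite -(scaleN1r (D y)) -N2 -(scaleN1r y); apply: linear_domD.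
Qed.

(** The graph of D is a closed subspace, so it has an orthogonal projection: a
   minimizing sequence is Cauchy by the parallelogram identity. *)
Lemma graph_projection u v : exists2 x, dom D x &
  forall z, dom D z -> ip z (u - x) + ip (D z) (v - D x) = 0.
Proof.
pose q x := nr (u - x) ^+ 2 + nr (v - D x) ^+ 2.
pose S := [set q x | x in dom D].
have S0 : S !=set0 by exists (q 0), 0 => //; exact: Dlin.1.
have q_ge0 x : 0 <= q x by rewrite addr_ge0// sqr_ge0.
have lbS : lbound S 0 by move=> _ [x _ <-].
have infS : has_inf S by split=> //; exists 0.
pose m := inf S.
have m_le x : dom D x -> m <= q x by move=> Dx; apply: ge_inf; [exists 0|exists x].
have ex n : exists x, dom D x /\ q x < m + n.+1%:R^-1.
  have [|_ [x Dx <-] hx] := @inf_adherent _ S n.+1%:R^-1 _ infS.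
    by rewrite invr_gt0.
  by exists x.
have [xs hxs] := choice ex.
(* the midpoint of a and b is in dom D, so its q-value is at least m *)
have key a b : dom D a -> dom D b -> nr (a - b) ^+ 2 + nr (D a - D b) ^+ 2
    <= 2 * (q a - m) + 2 * (q b - m).
  move=> Da Db.
  have [Dab DabE] := linear_domD Da Db.
  have [Dh DhE] := linear_domZ (((2^-1 : R)%:C)%C) Dab.
  have := m_le _ Dh; rewrite /q DhE DabE => hm.
  have par (w c d : H) : nr (c - d) ^+ 2 =
      2 * nr (w - c) ^+ 2 + 2 * nr (w - d) ^+ 2
      - 4 * nr (w - (((2^-1 : R)%:C)%C) *: (c + d)) ^+ 2.
    rewrite -!(rip_nr norm_dot) !(ripDl, ripDr, ripNl, ripNr, ripZl, ripZr).
    rewrite (ripC _ c w) (ripC _ d w) (ripC _ d c).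
    by field.
  by rewrite (par u a b) (par v (D a) (D b)); lra.
have small (e : R) : 0 < e -> exists N, forall i j, (N <= i)%N -> (N <= j)%N ->
    nr (xs i - xs j) < e /\ nr (D (xs i) - D (xs j)) < e.
  move=> e0; have e4 : 0 < e ^+ 2 / 4 by rewrite divr_gt0// exprn_gt0.
  have [N _ hN] := near_infty_natSinv_lt (PosNum e4).
  exists N => i j Ni Nj.
  have [Di qi] := hxs i; have [Dj qj] := hxs j.
  have := key _ _ Di Dj.
  have /= := hN i Ni; have /= := hN j Nj.
  have := sqr_ge0 (nr (xs i - xs j)); have := sqr_ge0 (nr (D (xs i) - D (xs j))).
  move: qi qj; move: (q _) (q _) (_^-1) (_^-1) => qi qj ti tj qi' qj' h1 h2 h3 h4 h5.
  by split; rewrite -(ltr_pXn2r (n:=2))// ?nnegrE ?nr_ge0 ?ltW//; lra.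
have [x xP] : exists l, forall e : R, 0 < e ->
    \forall n \near \oo, nr (xs n - l) < e.
  apply: cauchy_seq_cvg => e e0; have [N hN] := small e e0.
  by exists N => i j Ni Nj; have [] := hN i j Ni Nj.
have [y yP] : exists l, forall e : R, 0 < e ->
    \forall n \near \oo, nr (D (xs n) - l) < e.
  apply: cauchy_seq_cvg => e e0; have [N hN] := small e e0.
  by exists N => i j Ni Nj; have [] := hN i j Ni Nj.
have [Dx Dxy] : dom D x /\ D x = y.
  apply: closed_operatorP => // e e0.
  have [n [nx ny]] := filter_ex (filterI (xP e e0) (yP e e0)).
  by exists (xs n); split => //; have [] := hxs n.
exists x => //.
have qx : q x = m.
  apply/eqP; rewrite eq_le m_le// andbT; apply/ler_addgt0Pr => e e0.
  have c0 : 0 < nr (u - x) + nr (v - y) + 1 by rewrite ltr_wpDl ?addr_ge0 ?nr_ge0.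
  set c := (X in 0 < X) in c0.
  have d0 : 0 < e / (4 * c) by rewrite divr_gt0// mulr_gt0.
  have e2 : 0 < e / 2 by rewrite divr_gt0.
  have := filter_ex (filterI (near_infty_natSinv_lt (PosNum e2))
     (filterI (xP _ d0) (yP _ d0))).
  move=> [n [/= hn [nx ny]]].
  have [Dn qn] := hxs n.
  (* q is convex, so its value at the limit exceeds q (xs n) by at most the
     linear term *)
  have lin (w a b : H) : nr (w - b) ^+ 2 <= nr (w - a) ^+ 2
      + 2 * (nr (w - b) * nr (a - b)).
    have -> : w - a = (w - b) - (a - b) by rewrite opprB addrA subrK.
    rewrite (nrB_sqr norm_dot (w - b)); have := rip_le norm_dot (w - b) (a - b).
    by have := sqr_ge0 (nr (a - b)); lra.
  have := lin u (xs n) x; have := lin v (D (xs n)) y.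
  have b1 : nr (u - x) * nr (xs n - x) <= nr (u - x) * (e / (4 * c)).
    by rewrite ler_wpM2l ?nr_ge0// ltW.
  have b2 : nr (v - y) * nr (D (xs n) - y) <= nr (v - y) * (e / (4 * c)).
    by rewrite ler_wpM2l ?nr_ge0// ltW.
  have b3 : (nr (u - x) + nr (v - y) + 1) * (e / (4 * c)) = e / 4.
    by rewrite -/c; field; rewrite gt_eqF.
  rewrite /q Dxy => h1 h2; rewrite /q in qn.
  have {}hn : n.+1%:R^-1 < e / 2 := hn.
  move: b1 b2 b3 d0 h1 h2 qn hn; move: (e / (4 * c)) (n.+1%:R^-1) => k ni.
  by move=> b1 b2 b3 d0 h1 h2 qn hn; lra.
(* first variation of q at its minimum x in the direction z; the step t makes
   the second order term at most half of the first order one *)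
have rorth z : dom D z -> rip z (u - x) + rip (D z) (v - D x) = 0.
  move=> Dz.
  set r := rip z (u - x) + rip (D z) (v - D x).
  pose t := r / (nr z ^+ 2 + nr (D z) ^+ 2 + 1).
  have [Dtz DtzE] := linear_domZ ((t%:C)%C) Dz.
  have [Dxt DxtE] := linear_domD Dx Dtz.
  have := m_le _ Dxt; rewrite -qx /q DxtE DtzE !opprD !addrA.
  rewrite (nrB_sqr norm_dot (u - x)) (nrB_sqr norm_dot (v - D x)).
  rewrite !(nrZR norm_dot) !ripZr (ripC _ _ z) (ripC _ _ (D z)) => h.
  have n0 : 0 < nr z ^+ 2 + nr (D z) ^+ 2 + 1.
    by rewrite ltr_wpDl// addr_ge0// sqr_ge0.
  have h2 : 2 * t * r <= t ^+ 2 * (nr z ^+ 2 + nr (D z) ^+ 2) by rewrite /r; lra.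
  have h3 : 2 * t * r <= t * r.
    have -> : t * r = t ^+ 2 * (nr z ^+ 2 + nr (D z) ^+ 2 + 1).
      by rewrite /t; field; rewrite gt_eqF.
    by apply: le_trans h2 _; rewrite ler_wpM2l ?sqr_ge0// lerDl.
  have tr0 : 0 <= t * r.
    by rewrite /t mulrAC; apply: divr_ge0; [rewrite -expr2; exact: sqr_ge0|exact: ltW].
  have : t * r = 0 by lra.
  rewrite /t mulrAC -expr2 => /eqP; rewrite mulf_eq0 invr_eq0 (gt_eqF n0) orbF.
  by rewrite expf_eq0/= => /eqP.
move=> z Dz; set w := _ + _.
(* the imaginary part is the real part for 'i *: z *)
have [Diz DizE] := linear_domZ 'i Dz.
have re0 := rorth _ Dz; have im0 := rorth _ Diz.
move: re0 im0; rewrite DizE /rip !ipZl -!ReD -mulrDr -/w.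
rewrite conjCi -complexiE; case: (w) => a b /= -> h.
by congr Complex; move: h; lra.
Qed.
End Operators.

(** * The adjoint of a symmetric operator *)

Section SymmetricOperator.
Context (R : realType) (H : completeNormedModType R[i])
  (dot : {dot H for Num.conj}) (norm_dot : forall x, `|x| ^+ 2 = dot x x).
Local Notation ip := (ip dot).
Implicit Types x y z : H.
Context (D : operator H) (D_sym : closed_symmetric dot D).
Local Notation Dm := (hadjoint dot D).

Let Dlin : linear_operator D. Proof. by case: D_sym. Qed.
Let Dclosed : closed_operator D. Proof. by case: D_sym. Qed.
Let Ddense : dense (dom D). Proof. by case: D_sym. Qed.

Lemma dense_ip_eq0 z : (forall x, dom D x -> ip x z = 0) -> z = 0.
Proof.
move=> h; apply: nr_eq0; apply/eqP; rewrite eq_le nr_ge0 andbT.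
apply/ler_addgt0Pr => e e0; rewrite add0r.
have [x Dx xz] := dense_nr Ddense z e0.
have [z0|z0] := eqVneq (nr z) 0; first by rewrite z0 ltW.
have zp : 0 < nr z by rewrite lt_def z0 nr_ge0.
rewrite -(ler_pM2r zp) -expr2.
have -> : nr z ^+ 2 = nr (ip (z - x) z).
  by rewrite ipBl (h x Dx) subr0 (ip_nr norm_dot) nrR ger0_norm// sqr_ge0.
apply: le_trans (cauchy_schwarz norm_dot _ _) _.
by rewrite ler_wpM2r ?nr_ge0// nrBC ltW.
Qed.

(** Density of dom D makes the value of the adjoint unique. *)
Lemma hadjointP y z : (forall x, dom D x -> ip (D x) y = ip x z) <->
  dom Dm y /\ Dm y = z.
Proof.
have uniq w w' : (forall x, dom D x -> ip (D x) y = ip x w) ->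
    (forall x, dom D x -> ip (D x) y = ip x w') -> w = w'.
  move=> h h'; apply/eqP; rewrite -subr_eq0; apply/eqP; apply: dense_ip_eq0.
  by move=> x Dx; rewrite ipBr -h// -h'// subrr.
have val w : (forall x, dom D x -> ip (D x) y = ip x w) -> Dm y = w.
  move=> h; rewrite /hadjoint/=; apply: xget_unique; first by split.
  by move=> w' [_ h']; exact: uniq h' h.
split=> [h|[[_ [w [_ h]]] yz]]; last by rewrite -yz (val _ h).
by split; [split=> //; exists z; split|exact: val].
Qed.

Lemma hadjoint_ip x y : dom D x -> dom Dm y -> ip (D x) y = ip x (Dm y).
Proof. by move=> Dx Dy; exact: (hadjointP y (Dm y)).2. Qed.

Lemma hadjoint_linear : linear_operator Dm.
Proof.
split.
  by apply: (proj1 ((hadjointP 0 0).1 _)) => x _; rewrite !ip0r.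
move=> a x y Dx Dy; apply/hadjointP => z Dz.
by rewrite !ipDr !ipZr !hadjoint_ip.
Qed.

Lemma hadjoint_ext x : dom D x -> dom Dm x /\ Dm x = D x.
Proof. by move=> Dx; apply/hadjointP => y Dy; case: D_sym => _ _ _; exact. Qed.

Lemma hadjoint_closed : closed_operator Dm.
Proof.
apply: closed_operator_of => x y h; apply/hadjointP => z Dz.
apply/eqP; rewrite -subr_eq0; apply/eqP; apply: nr_eq0.
apply/eqP; rewrite eq_le nr_ge0 andbT; apply/ler_addgt0Pr => e e0; rewrite add0r.
pose c := nr (D z) + nr z + 1.
have c0 : 0 < c by rewrite ltr_wpDl// addr_ge0// nr_ge0.
have d0 : 0 < e / c by rewrite divr_gt0.
have [w [Dw wx wy]] := h _ d0.
have -> : ip (D z) x - ip z y = ip z (Dm w - y) - ip (D z) (w - x).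
  by rewrite !ipBr (hadjoint_ip Dz Dw); ring.
apply: le_trans (nrB _ _) _.
have h1 := cauchy_schwarz norm_dot z (Dm w - y).
have h2 := cauchy_schwarz norm_dot (D z) (w - x).
have h3 : nr z * nr (Dm w - y) <= nr z * (e / c).
  by rewrite ler_wpM2l ?nr_ge0// ltW.
have h4 : nr (D z) * nr (w - x) <= nr (D z) * (e / c).
  by rewrite ler_wpM2l ?nr_ge0// ltW.
have h5 : (nr (D z) + nr z + 1) * (e / c) = e.
  by rewrite -/c; field; rewrite gt_eqF.
by move: (e / c) d0 h3 h4 h5 {wx wy} => k; lra.
Qed.

(** Orthogonality in the graph of D to the projection of (h, 0) says exactly
   that h - x = D^* (D x). *)
Lemma resolvent_exists h : exists x, [/\ dom D x, dom Dm (D x) &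
  x + Dm (D x) = h].
Proof.
have [x Dx hx] := graph_projection norm_dot Dlin Dclosed h 0.
exists x; have [DDx DDxE] : dom Dm (D x) /\ Dm (D x) = h - x.
  apply/hadjointP => z Dz; have := hx z Dz.
  by rewrite sub0r ipNr => /eqP; rewrite subr_eq0 => /eqP.
by split => //; rewrite DDxE addrC subrK.
Qed.

(** The operator (1 + D^* D)^-1. *)
Definition resolvent h : H := projT1 (cid (resolvent_exists h)).

Lemma resolventP h : [/\ dom D (resolvent h), dom Dm (D (resolvent h)) &
  resolvent h + Dm (D (resolvent h)) = h].
Proof. exact: (projT2 (cid (resolvent_exists h))). Qed.

(** Pairing x with x + D^* (D x) gives |x|^2 + |D x|^2. *)
Lemma resolvent_bound x : dom D x -> dom Dm (D x) ->
  nr x <= nr (x + Dm (D x)) /\ nr (D x) <= nr (x + Dm (D x)).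
Proof.
move=> Dx DDx; set h := x + _.
have E : nr x ^+ 2 + nr (D x) ^+ 2 = rip dot x h.
  rewrite /h ripDr -!(rip_nr norm_dot); congr (_ + _).
  by rewrite /rip (hadjoint_ip Dx DDx).
have L := rip_le norm_dot x h.
have x1 : nr x <= nr h.
  have [x0|x0] := eqVneq (nr x) 0; first by rewrite x0 nr_ge0.
  have xp : 0 < nr x by rewrite lt_def x0 nr_ge0.
  by rewrite -(ler_pM2l xp) -expr2; have := sqr_ge0 (nr (D x)); lra.
split=> //; rewrite -(ler_pXn2r (n:=2)) ?nnegrE ?nr_ge0//.
have := sqr_ge0 (nr x).
have : nr x * nr h <= nr h ^+ 2 by rewrite expr2 ler_wpM2r ?nr_ge0.
by lra.
Qed.

Lemma resolvent_lipschitz h k : nr (resolvent h - resolvent k) <= nr (h - k) /\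
  nr (D (resolvent h) - D (resolvent k)) <= nr (h - k).
Proof.
have [h1 h2 h3] := resolventP h; have [k1 k2 k3] := resolventP k.
have [e1 e2] := linear_domB Dlin h1 k1.
have [g1 g2] := linear_domB hadjoint_linear h2 k2.
rewrite -e2 in g1 g2.
have := resolvent_bound e1 g1.
by rewrite g2 addrACA h3 -opprD k3 e2.
Qed.

Lemma resolvent0 : resolvent 0 = 0 /\ D (resolvent 0) = 0.
Proof.
have [h1 h2 h3] := resolventP 0.
have [] := resolvent_bound h1 h2; rewrite h3 nr0 => a b.
by split; apply: nr_eq0; apply/eqP; rewrite eq_le nr_ge0 ?a ?b.
Qed.

(** resolvent h minimizes |h - z|^2 + |D z|^2. Applied to a small multiple of D
   this shows that h is close to resolvent h. *)
Lemma resolvent_approx h z : dom D z ->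
  nr (h - resolvent h) ^+ 2 <= nr (h - z) ^+ 2 + nr (D z) ^+ 2.
Proof.
move=> Dz; have [Dx DDx hE] := resolventP h.
set x := resolvent h in Dx DDx hE *.
have [Dzx DzxE] := linear_domB Dlin Dz Dx.
have hx : h - x = Dm (D x) by rewrite -{1}hE addrC addKr.
have E : rip dot (z - x) (h - x) = rip dot (D z - D x) (D x).
  by rewrite hx /rip -DzxE (hadjoint_ip Dzx DDx).
have -> : h - z = (h - x) - (z - x) by rewrite opprB addrA subrK.
rewrite (nrB_sqr norm_dot (h - x)) (ripC _ (h - x)) E.
have -> : nr (D z) = nr ((D z - D x) + D x) by rewrite subrK.
rewrite (nrD_sqr norm_dot (D z - D x)).
have := sqr_ge0 (nr (z - x)); have := sqr_ge0 (nr (D z - D x)).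
by have := sqr_ge0 (nr (D x)); lra.
Qed.
End SymmetricOperator.

Section Scaling.
Context (R : realType) (H : completeNormedModType R[i])
  (dot : {dot H for Num.conj}).
Context (D : operator H) (D_sym : closed_symmetric dot D).

Definition scale_op (s : R) : operator H :=
  Operator (dom D) (fun x => (s%:C)%C *: D x).

Lemma scale_op_symmetric (s : R) : 0 < s -> closed_symmetric dot (scale_op s).
Proof.
move=> s0; have [Dlin Dd Dc Ds] := D_sym; split=> //.
- split; first exact: Dlin.1.
  move=> a x y Dx Dy; have [D1 D2] := Dlin.2 a x y Dx Dy; split => //=.
  by rewrite D2 scalerDr !scalerA mulrC.
- apply: closed_operator_of => x y h.
  have [Dx Dxy] : dom D x /\ D x = ((s^-1)%:C)%C *: y.
    apply: closed_operatorP => // e e0.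
    have m0 : 0 < Num.min e (e * s) by rewrite lt_min e0 mulr_gt0.
    have [z [Dz zx zy]] := h _ m0; exists z; split=> //.
      by rewrite (lt_le_trans zx)// ge_min lexx.
    have -> : D z - ((s^-1)%:C)%C *: y = ((s^-1)%:C)%C *: ((s%:C)%C *: D z - y).
      rewrite scalerBr scalerA -rmorphM/= mulVf ?gt_eqF//.
      by rewrite (_ : (1%:C)%C = 1)// scale1r.
    rewrite nrZ nrR gtr0_norm ?invr_gt0// mulrC ltr_pdivrMr//.
    by rewrite (lt_le_trans zy)// ge_min lexx orbT.
  split=> //=; rewrite Dxy scalerA -rmorphM/= mulfV ?gt_eqF//.
  by rewrite (_ : (1%:C)%C = 1)// scale1r.
- move=> x y Dx Dy /=; rewrite ipZr ipZl Ds//.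
  by rewrite (_ : ((s%:C)%C)^* = (s%:C)%C)// conj_Creal// complex_real.
Qed.
End Scaling.

(** * Boundary values of the maximal operator *)

Section Deficiency.
Context (R : realType) (H : completeNormedModType R[i])
  (dot : {dot H for Num.conj}) (norm_dot : forall x, `|x| ^+ 2 = dot x x).
Local Notation ip := (ip dot).
Implicit Types x y z : H.
Context (D : operator H) (D_sym : closed_symmetric dot D)
    (D_def : deficiency_indices dot D 1 1)
    (phip phim : H)
    (phip_def : deficiency_space dot D 'i phip)
    (phim_def : deficiency_space dot D (- 'i) phim)
    (phip_norm : graph_norm dot (hadjoint dot D) phip = 1)
    (phim_norm : graph_norm dot (hadjoint dot D) phim = 1).
Local Notation Dm := (hadjoint dot D).
Local Notation alp := (graph_ip dot Dm phip).
Local Notation alm := (graph_ip dot Dm phim).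

Let Dlin : linear_operator D. Proof. by case: D_sym. Qed.
Let Dclosed : closed_operator D. Proof. by case: D_sym. Qed.
Let Dmlin : linear_operator Dm. Proof. exact: hadjoint_linear. Qed.

Lemma one_dim_span (W : set H) x y : has_dim W 1 -> W x -> x <> 0 -> W y ->
  exists a, y = a *: x.
Proof.
move=> [e [-> _]] [c _ <-] + [d _ <-]; rewrite !big_ord1 => ce.
have c0 : c ord0 != 0.
  by apply/eqP => c0; apply: ce; rewrite c0 scale0r.
by exists (d ord0 / c ord0); rewrite scalerA divfK.
Qed.

Lemma alpE x : alp x = ip phip x - 'i * ip phip (Dm x).
Proof. by case: phip_def => _ E; rewrite /graph_ip E ipZl conjCi mulNr. Qed.

Lemma almE x : alm x = ip phim x + 'i * ip phim (Dm x).
Proof.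
by case: phim_def => _ E; rewrite /graph_ip E ipZl rmorphN/= conjCi opprK.
Qed.

Lemma ii : 'i * 'i = -1 :> R[i].
Proof. by rewrite -expr2 sqrCi. Qed.

Lemma graph_ip_norm phi :
  graph_norm dot Dm phi = 1 -> graph_ip dot Dm phi phi = 1.
Proof. by rewrite /graph_norm => /(congr1 (fun t => t ^+ 2)); rewrite sqrtCK expr1n. Qed.

Lemma phip_half : ip phip phip = 2^-1.
Proof.
have := graph_ip_norm phip_norm; rewrite alpE; case: phip_def => _ ->.
rewrite ipZr mulrA ii mulN1r opprK => h.
by rewrite -[LHS](mulfK (_ : 2 != 0)) ?pnatr_eq0// mulr_natr mulr2n h mul1r.
Qed.

Lemma phim_half : ip phim phim = 2^-1.
Proof.
have := graph_ip_norm phim_norm; rewrite almE; case: phim_def => _ ->.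
rewrite ipZr mulrA mulrN ii opprK mul1r => h.
by rewrite -[LHS](mulfK (_ : 2 != 0)) ?pnatr_eq0// mulr_natr mulr2n h mul1r.
Qed.

Lemma phip_neq0 : phip <> 0.
Proof.
move=> p0; have := phip_half; rewrite p0 ip0r => /eqP.
by rewrite eq_sym invr_eq0 pnatr_eq0.
Qed.

Lemma phim_neq0 : phim <> 0.
Proof.
move=> p0; have := phim_half; rewrite p0 ip0r => /eqP.
by rewrite eq_sym invr_eq0 pnatr_eq0.
Qed.

Lemma graph_ipD phi x y : dom Dm x -> dom Dm y ->
  graph_ip dot Dm phi (x + y) = graph_ip dot Dm phi x + graph_ip dot Dm phi y.
Proof.
by move=> Dx Dy; rewrite /graph_ip (linear_domD Dmlin Dx Dy).2 !ipDr addrACA.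
Qed.

Lemma graph_ipZ phi a x : dom Dm x ->
  graph_ip dot Dm phi (a *: x) = a * graph_ip dot Dm phi x.
Proof.
by move=> Dx; rewrite /graph_ip (linear_domZ Dmlin a Dx).2 !ipZr mulrDr.
Qed.

Lemma alp_phip : alp phip = 1. Proof. exact: graph_ip_norm. Qed.
Lemma alm_phim : alm phim = 1. Proof. exact: graph_ip_norm. Qed.

Lemma alp_phim : alp phim = 0.
Proof.
rewrite alpE; case: phim_def => _ ->.
by rewrite ipZr mulrA mulrN ii opprK mul1r subrr.
Qed.

Lemma alm_phip : alm phip = 0.
Proof.
by rewrite almE; case: phip_def => _ ->; rewrite ipZr mulrA ii mulN1r subrr.
Qed.

Lemma ip_phip_D x : dom D x -> ip phip (D x) = - 'i * ip phip x.
Proof.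
move=> Dx; case: phip_def => pD pE.
by rewrite ipC (hadjoint_ip norm_dot D_sym Dx pD) pE ipZr rmorphM/= conjCi -ipC.
Qed.

Lemma ip_phim_D x : dom D x -> ip phim (D x) = 'i * ip phim x.
Proof.
move=> Dx; case: phim_def => pD pE.
rewrite ipC (hadjoint_ip norm_dot D_sym Dx pD) pE ipZr rmorphM/= rmorphN/= conjCi.
by rewrite opprK -ipC.
Qed.

(** The eigenvectors are orthogonal to dom D for the graph inner product. *)
Lemma alpha_dom x : dom D x -> alp x = 0 /\ alm x = 0.
Proof.
move=> Dx; rewrite alpE almE (hadjoint_ext norm_dot D_sym Dx).2.
rewrite ip_phip_D// ip_phim_D// !mulrA mulrN !ii opprK mul1r mulN1r.
by rewrite !subrr.
Qed.

(** If x0 is the projection of x on dom D in the graph of D^*, then w = x - x0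
   satisfies D^* D^* w = - w, and w splits into eigenvectors of D^*. *)
Lemma von_neumann x : dom Dm x ->
  exists2 x0, dom D x0 & x = x0 + (alp x *: phip + alm x *: phim).
Proof.
move=> Dx.
have [x0 Dx0 orth] := graph_projection norm_dot Dlin Dclosed x (Dm x).
have [Dmx0 Dmx0E] := hadjoint_ext norm_dot D_sym Dx0.
have [wD wE] := linear_domB Dmlin Dx Dmx0.
set w := x - x0 in orth wD wE.
have [vD vE] : dom Dm (Dm w) /\ Dm (Dm w) = - w.
  apply/hadjointP => // z Dz; rewrite wE Dmx0E ipNr.
  by apply/eqP; rewrite eq_sym -subr_eq0 -opprD oppr_eq0 orth.
(* w is the sum of its components (w - 'i D^* w) / 2 and (w + 'i D^* w) / 2 *)
have split_ c : c * c = -1 -> exists2 p, deficiency_space dot D c p &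
    p = 2^-1 *: (w - c *: Dm w).
  move=> cc; exists (2^-1 *: (w - c *: Dm w)) => //.
  have [c1 c2] := linear_domZ Dmlin c vD.
  have [d1 d2] := linear_domB Dmlin wD c1.
  have [e1 e2] := linear_domZ Dmlin 2^-1 d1.
  split=> //; rewrite e2 d2 c2 vE scalerA mulrC -scalerA; congr (_ *: _).
  by rewrite scalerBr scalerA cc scaleN1r scalerN !opprK addrC.
have [p pS pE] := split_ 'i ii.
have [|m mS mE] := split_ (- 'i); first by rewrite mulrNN ii.
have [a aE] := one_dim_span D_def.1 phip_def phip_neq0 pS.
have [b bE] := one_dim_span D_def.2 phim_def phim_neq0 mS.
have wE' : w = a *: phip + b *: phim.
  rewrite -aE -bE pE mE -scalerDr scaleNr opprK addrACA addNr addr0.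
  by rewrite -mulr2n -(scaler_nat 2 w) scalerA mulVf ?scale1r ?pnatr_eq0.
have xE : x = x0 + (a *: phip + b *: phim) by rewrite -wE' /w addrC subrK.
have [pD _] := phip_def; have [mD _] := phim_def.
have [pD' _] := linear_domZ Dmlin a pD; have [mD' _] := linear_domZ Dmlin b mD.
have [pm _] := linear_domD Dmlin pD' mD'.
have [ap am] := alpha_dom Dx0.
exists x0 => //; rewrite {1}xE; congr (_ + (_ *: _ + _ *: _)).
  rewrite xE !graph_ipD// !graph_ipZ// ap alp_phip alp_phim.
  by rewrite mulr1 mulr0 addr0 add0r.
rewrite xE !graph_ipD// !graph_ipZ// am alm_phip alm_phim.
by rewrite mulr1 mulr0 !add0r.
Qed.

Lemma dom_alpha x : dom Dm x -> alp x = 0 -> alm x = 0 -> dom D x.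
Proof.
move=> Dx ap am; have [x0 Dx0 ->] := von_neumann Dx.
by rewrite ap am !scale0r !addr0.
Qed.

(** dom D does not contribute to the boundary form, which is therefore determined
   by its values on the eigenvectors; both of these have squared norm 1/2 in H. *)
Lemma boundary_form x y : dom Dm x -> dom Dm y ->
  ip (Dm x) y - ip x (Dm y) =
  - 'i * ((alp x)^* * alp y - (alm x)^* * alm y).
Proof.
move=> Dx Dy; have [x0 Dx0 xE] := von_neumann Dx.
have [y0 Dy0 yE] := von_neumann Dy.
have [pD pE] := phip_def; have [mD mE] := phim_def.
have dom1 a b : dom Dm (a *: phip + b *: phim) /\
    Dm (a *: phip + b *: phim) = a *: ('i *: phip) + b *: (- 'i *: phim).
  have [pD' pE'] := linear_domZ Dmlin a pD; have [mD' mE'] := linear_domZ Dmlin b mD.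
  by have [pm pmE] := linear_domD Dmlin pD' mD'; rewrite pmE pE' mE' pE mE.
move: xE yE; move: (alp x) (alm x) (alp y) (alm y) => a b c d xE yE.
have [x1D x1E] := dom1 a b; have [y1D y1E] := dom1 c d.
have [Dmx0 Dmx0E] := hadjoint_ext norm_dot D_sym Dx0.
have [Dmy0 Dmy0E] := hadjoint_ext norm_dot D_sym Dy0.
have B1 := hadjoint_ip norm_dot D_sym Dx0 Dy.
have B2 := hadjoint_ip norm_dot D_sym Dy0 x1D.
move/(congr1 Num.conj): B2; rewrite -!ipC => B2.
have DxE : Dm x = D x0 + Dm (a *: phip + b *: phim).
  by rewrite xE (linear_domD Dmlin Dmx0 x1D).2 Dmx0E.
have DyE : Dm y = D y0 + Dm (c *: phip + d *: phim).
  by rewrite yE (linear_domD Dmlin Dmy0 y1D).2 Dmy0E.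
transitivity (ip (Dm (a *: phip + b *: phim)) y - ip (a *: phip + b *: phim) (Dm y)).
  by rewrite DxE {1}xE !ipDl B1; ring.
rewrite DyE yE !ipDr B2 x1E y1E !(ipDl, ipDr, ipZl, ipZr).
rewrite phip_half phim_half rmorphN/= conjCi.
by field.
Qed.

Lemma alpha_Dp x : dom D x -> dom Dm (D x) ->
  alp (D x) = - 'i * ip phip (x + Dm (D x)).
Proof.
move=> Dx DDx; rewrite alpE ip_phip_D// ipDr; ring.
Qed.

Lemma alpha_Dm x : dom D x -> dom Dm (D x) ->
  alm (D x) = 'i * ip phim (x + Dm (D x)).
Proof.
move=> Dx DDx; rewrite almE ip_phim_D// ipDr; ring.
Qed.

(** Otherwise the component of phip orthogonal to phim would be orthogonal to phip
   as well, hence 0, but eigenvectors for different eigenvalues are independent. *)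
Lemma ip_phi_separate : exists h, nr (ip phip h) <> nr (ip phim h).
Proof.
apply: contrapT => /forallNP H0.
have {}H0 h : nr (ip phip h) = nr (ip phim h) by apply: contrapT; exact: H0.
pose c := 2 * ip phim phip; pose h := phip - c *: phim.
have mh : ip phim h = 0.
  by rewrite ipBr ipZr phim_half /c; field.
have ph : ip phip h = 0 by apply: nr_eq0; rewrite H0 mh nr0.
have hh : ip h h = 0 by rewrite {1}/h ipBl ipZl ph mh mulr0 subr0.
have h0 : h = 0.
  apply: nr_eq0; move: hh; rewrite (ip_nr norm_dot) => /(@complexI R _ 0)/eqP.
  by rewrite expf_eq0/= => /eqP.
have pE : phip = c *: phim by apply/eqP; rewrite -subr_eq0 -/h h0.
have : alp (c *: phim) = 1 by rewrite -pE alp_phip.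
rewrite graph_ipZ ?alp_phim ?mulr0; last by case: phim_def.
by move/eqP; rewrite eq_sym oner_eq0.
Qed.
End Deficiency.

(** * Continuous functions vanishing at infinity *)

Section Continuity.
Context (R : realType) (X : topologicalType).

(** Continuity at p in the form used by C0, which makes sense for a group with a
   norm and no topology. *)
Definition ncont (V : normedZmodType R[i]) (f : X -> V) (p : X) :=
  forall e : R, 0 < e -> \forall q \near p, nr (f q - f p) < e.

Definition vanish (V : normedZmodType R[i]) (f : X -> V) :=
  forall e : R, 0 < e ->
    exists2 A : set X, compact A & forall x, ~ A x -> nr (f x) < e.

Lemma realC_gt0 (e : R) : (0 < (e%:C)%C) = (0 < e).
Proof. by rewrite -[0]/((0%:C)%C) ltcR. Qed.

Lemma ncontP (V : normedModType R[i]) (f : X -> V) p :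
  ncont f p <-> {for p, continuous f}.
Proof.
split=> [h|/cvgrPdist_lt h e e0].
  apply/cvgrPdist_lt => _ /posC[e e0 ->]; have := h e e0.
  by apply: filterS => q; rewrite norm_lt nrBC.
have := h (e%:C)%C; rewrite realC_gt0 => /(_ e0).
by apply: filterS => q; rewrite norm_lt nrBC.
Qed.

Lemma C0P (V : normedZmodType R[i]) (f : X -> V) :
  C0 setT (fun v => `|v|) f <-> (forall p, ncont f p) /\ vanish f.
Proof.
split=> [[_ c v]|[c v]].
  split=> [p e e0|e e0].
    have := c p (e%:C)%C; rewrite realC_gt0 => /(_ e0).
    by apply: filterS => q; rewrite norm_lt.
  have := v (e%:C)%C; rewrite realC_gt0 => /(_ e0)[A cA h].
  by exists A => // x /h; rewrite norm_lt.
split=> // [p _ /posC[e e0 ->]|_ /posC[e e0 ->]].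
  by have := c p e e0; apply: filterS => q; rewrite norm_lt.
by have [A cA h] := v e e0; exists A => // x /h; rewrite norm_lt.
Qed.

Lemma ncont_lip (V W : normedZmodType R[i]) (A : V -> W) (C : R) f p :
  0 < C -> (forall y z, nr (A y - A z) <= C * nr (y - z)) ->
  ncont f p -> ncont (A \o f) p.
Proof.
move=> C0 AC fp e e0; have := fp (e / C); rewrite divr_gt0// => /(_ erefl).
apply: filterS => q; rewrite ltr_pdivlMr// mulrC; apply: le_lt_trans; exact: AC.
Qed.

Lemma ncontD (V : normedZmodType R[i]) (f g : X -> V) p :
  ncont f p -> ncont g p -> ncont (fun x => f x + g x) p.
Proof.
move=> fp gp e e0; have e2 : 0 < e / 2 by rewrite divr_gt0.
apply: filterS2 (fp _ e2) (gp _ e2) => q h1 h2.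
rewrite opprD addrACA; apply: le_lt_trans (nrD _ _) _.
by rewrite [ltRHS](splitr e) ltrD.
Qed.

Lemma ncontZ (V : normedModType R[i]) (a : X -> R[i]^o) (f : X -> V) p :
  ncont a p -> ncont f p -> ncont (fun x => a x *: f x) p.
Proof. by move=> /ncontP ap /ncontP fp; apply/ncontP; exact: cvgZ. Qed.

Lemma ncontM (a b : X -> R[i]^o) p :
  ncont a p -> ncont b p -> ncont (fun x => a x * b x : R[i]^o) p.
Proof. by move=> ap bp; exact: (ncontZ (V := R[i]^o)). Qed.

Lemma ncontV (a : X -> R[i]^o) p :
  ncont a p -> a p != 0 -> ncont (fun x => (a x)^-1 : R[i]^o) p.
Proof.
by move=> /ncontP ap a0; apply/ncontP; exact: cvgV.
Qed.

Lemma ncont_cst (V : normedZmodType R[i]) (v : V) p : ncont (fun=> v) p.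
Proof. by move=> e e0; near=> q; rewrite subrr nr0. Unshelve. all: by end_near. Qed.

Lemma ncont_near (V : normedZmodType R[i]) (f g : X -> V) p :
  (\forall q \near p, f q = g q) -> ncont f p -> ncont g p.
Proof.
move=> fg fp e e0; have fgp := nbhs_singleton fg.
by apply: filterS2 fg (fp e e0) => q <-; rewrite -fgp.
Qed.

Lemma ncont_conj (a : X -> R[i]^o) p :
  ncont a p -> ncont (fun x => (a x)^* : R[i]^o) p.
Proof.
move=> ap; apply: (ncont_lip (V := R[i]^o) (W := R[i]^o) (A := fun z => z^*) (C := 1)) => // y z.
by rewrite mul1r /= -rmorphB/= nr_conj.
Qed.

Lemma ncont_neq0 (V : normedZmodType R[i]) (f : X -> V) p :
  ncont f p -> f p != 0 -> \forall q \near p, f q != 0.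
Proof.
move=> fp f0; have n0 : 0 < nr (f p).
  by rewrite lt_def nr_ge0 andbT; apply: contra f0 => /eqP/nr_eq0 ->.
have := fp _ n0; apply: filterS => q; apply: contraTN => /eqP ->.
by rewrite sub0r nrN ltxx.
Qed.

Lemma ncont_closure_eq (V : normedZmodType R[i]) (f g : X -> V) (S : set X) p :
  ncont f p -> ncont g p -> (forall q, S q -> f q = g q) -> closure S p ->
  f p = g p.
Proof.
move=> fp gp fg Sp; apply/eqP; rewrite -subr_eq0; apply/eqP; apply: nr_eq0.
apply/eqP; rewrite eq_le nr_ge0 andbT; apply/ler_addgt0Pr => e e0; rewrite add0r.
have e2 : 0 < e / 2 by rewrite divr_gt0.
have [q [Sq [h1 h2]]] := Sp _ (filterI (fp _ e2) (gp _ e2)).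
have -> : f p - g p = (g q - g p) - (f q - f p).
  by rewrite (fg q Sq) opprB [RHS]addrC subrKA.
apply: le_trans (nrB _ _) _; move: h1 h2; lra.
Qed.

Lemma vanish_le (V W : normedZmodType R[i]) (f : X -> V) (g : X -> W) (C : R) :
  0 < C -> (forall x, nr (g x) <= C * nr (f x)) -> vanish f -> vanish g.
Proof.
move=> C0 h fv e e0; have [A cA hA] := fv (e / C) (divr_gt0 e0 C0).
exists A => // x Ax; apply: le_lt_trans (h x) _.
by rewrite mulrC -ltr_pdivlMr//; exact: hA.
Qed.

Lemma vanishD (V : normedZmodType R[i]) (f g : X -> V) :
  vanish f -> vanish g -> vanish (fun x => f x + g x).
Proof.
move=> fv gv e e0; have e2 : 0 < e / 2 by rewrite divr_gt0.
have [A cA hA] := fv _ e2; have [B cB hB] := gv _ e2.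
exists (A `|` B); first exact: compactU.
move=> x /not_orP[/hA h1 /hB h2]; apply: le_lt_trans (nrD _ _) _.
by rewrite [ltRHS](splitr e) ltrD.
Qed.

Lemma vanish_compact (V : normedZmodType R[i]) (f : X -> V) (A : set X) :
  compact A -> (forall x, ~ A x -> f x = 0) -> vanish f.
Proof. by move=> cA h e e0; exists A => // x /h ->; rewrite nr0. Qed.

Lemma C0_closed (V : normedZmodType R[i]) (f : X -> V) :
  (forall e : R, 0 < e -> exists h : X -> V, C0 setT (fun v => `|v|) h /\
     forall x, nr (h x - f x) < e) -> C0 setT (fun v => `|v|) f.
Proof.
move=> H; apply/C0P; split.
  move=> p e e0; have e3 : 0 < e / 3 by rewrite divr_gt0.
  have [h [/C0P[hc _] hf]] := H _ e3.
  have := hc p _ e3; apply: filterS => q hq.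
  have -> : f q - f p = (h q - h p) - (h q - f q) + (h p - f p).
    by rewrite opprB [X in _ = X + _]addrC !subrKA.
  apply: le_lt_trans (nrD _ _) _; have := hf p; have := hf q.
  by have := nrB (h q - h p) (h q - f q); lra.
move=> e e0; have e2 : 0 < e / 2 by rewrite divr_gt0.
have [h [/C0P[_ hv] hf]] := H _ e2; have [A cA hA] := hv _ e2.
exists A => // x /hA hx; have -> : f x = h x - (h x - f x) by rewrite opprB addrC subrK.
by apply: le_lt_trans (nrB _ _) _; have := hf x; lra.
Qed.

Lemma C0_Z (V : normedModType R[i]) (a : X -> R[i]) (f : X -> V) :
  C0 setT (fun z : R[i] => `|z|) a -> C0 setT (fun v => `|v|) f ->
  C0 setT (fun v => `|v|) (fun x => a x *: f x).
Proof.
move=> /C0P[ac av] /C0P[fc fv]; apply/C0P; split.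
  by move=> p; apply: (ncontZ (a := a)); [exact: ac|exact: fc].
move=> e e0; have [A cA hA] := av 1 ltr01; have [B cB hB] := fv _ e0.
exists (A `|` B); first exact: compactU.
move=> x /not_orP[/hA h1 /hB h2]; rewrite nrZ.
apply: le_lt_trans h2; rewrite -[leRHS]mul1r ler_wpM2r ?nr_ge0// ltW//.
Qed.

Lemma C0_D (V : normedZmodType R[i]) (f g : X -> V) :
  C0 setT (fun v => `|v|) f -> C0 setT (fun v => `|v|) g ->
  C0 setT (fun v => `|v|) (fun x => f x + g x).
Proof.
move=> /C0P[fc fv] /C0P[gc gv]; apply/C0P; split; last exact: vanishD.
by move=> p; exact: ncontD.
Qed.

Lemma C0_lip (V W : normedZmodType R[i]) (A : V -> W) (C : R) (f : X -> V) :
  0 < C -> (forall y z, nr (A y - A z) <= C * nr (y - z)) -> A 0 = 0 ->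
  C0 setT (fun v => `|v|) f -> C0 setT (fun v => `|v|) (A \o f).
Proof.
move=> C0 AC A0 /C0P[fc fv]; apply/C0P; split.
  by move=> p; exact: ncont_lip AC (fc p).
apply: (vanish_le C0 _ fv) => x; have := AC (f x) 0.
by rewrite A0 (subr0 (f x)) subr0; apply.
Qed.

Lemma C0_scal (V : normedModType R[i]) (W : normedZmodType R[i])
    (b : X -> R[i]^o) (v : V) (f : X -> W) (C : R) :
  0 < C -> (forall p, ncont b p) -> (forall x, nr (b x) <= C * nr (f x)) ->
  vanish f -> C0 setT (fun v : V => `|v|) (fun x => b x *: v).
Proof.
move=> C0 bc bf fv; apply/C0P; split.
  by move=> p; apply: ncontZ => //; exact: ncont_cst.
apply: (vanish_le (C := C * (nr v + 1)) _ _ fv).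
  by rewrite mulr_gt0// ltr_wpDl// nr_ge0.
move=> x; rewrite nrZ mulrAC; apply: ler_pM; rewrite ?nr_ge0//.
by rewrite lerDl.
Qed.

End Continuity.

Section Bump.
Context (R : realType) (X : topologicalType) (lcX : locally_compact [set: X])
  (T2X : hausdorff_space X).

(** A locally compact Hausdorff space is completely regular; a function g that
   vanishes at p and is 1 outside a compact neighbourhood inside U is turned
   into max (0, 1 - 2 g), whose support lies in the set where g is at most 1/2. *)
Lemma bump (p : X) (U : set X) : open U -> U p ->
  exists (chi : X -> R[i]^o) (A : set X),
    [/\ forall q, ncont chi q, chi p = 1, A `<=` U, compact A /\ closed A &
        forall q, ~ A q -> chi q = 0].
Proof.
move=> oU Up; have [W] := lcX (I : [set: X] p); rewrite withinET => pW [cW clW].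
pose V := U `&` W°.
have oV : open V by apply: openI => //; exact: open_interior.
have Vp : V p by split.
have crX := @locally_compact_completely_regular X R lcX T2X.
have /uniform_separatorP := crX p (~` V) (open_closedC oV) (fun h => h Vp).
move=> /(_ R)[g [gc g01 gp gV]].
have gp0 : g p = 0 by apply: gp; exists p.
have gV1 q : ~ V q -> g q = 1 by move=> Vq; apply: gV; exists q.
exists (fun q => ((Num.max 0 (1 - 2 * g q))%:C)%C), [set q | g q <= 2^-1].
have AV : [set q | g q <= 2^-1] `<=` V.
  by move=> q /= gq; apply: contrapT => /gV1 gq1; move: gq; rewrite gq1; lra.
have clA : closed [set q | g q <= 2^-1].
  rewrite (_ : [set q | _] = g @^-1` [set x | x <= 2^-1])//.
  by apply: preimage_closed => [q _|]; [exact: gc|exact: closed_le].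
split => //.
- move=> q e e0; have e2 : 0 < e / 2 by rewrite divr_gt0.
  have /cvgrPdist_lt/(_ _ e2) := gc q.
  apply: filterS => r; rewrite -rmorphB/= nrR ltr_norml => /andP[h1 h2].
  rewrite /Num.max; do 2 case: ifPn; rewrite -?leNgt => h3 h4;
    rewrite ltr_norml; apply/andP; split; lra.
- by rewrite gp0 mulr0 subr0 max_r.
- by move=> q /AV[].
- split=> //; apply: (subclosed_compact clA cW) => q /AV[_]; exact: interior_subset.
- move=> q /negP; rewrite -ltNge => h; rewrite max_l//.
  by rewrite -/(g q) in h; move: h; lra.
Qed.

(** The product is continuous outside U too, as chi vanishes on the open
   complement of A. *)
Lemma bump_C0 (V : normedModType R[i]) (chi : X -> R[i]^o) (A U : set X)
    (v : X -> V) :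
  (forall q, ncont chi q) -> A `<=` U -> compact A -> closed A ->
  (forall q, ~ A q -> chi q = 0) -> (forall q, U q -> ncont v q) ->
  C0 setT (fun v => `|v|) (fun x => chi x *: v x).
Proof.
move=> chic AU cA clA chi0 vc; apply/C0P; split; last first.
  by apply: (vanish_compact cA) => x /chi0 ->; rewrite scale0r.
move=> q; have [Aq|Aq] := pselect (A q).
  by apply: ncontZ => //; apply: vc; exact: AU.
apply: (ncont_near (f := fun=> 0)) (ncont_cst _ _).
have : nbhs q (~` A) by apply: open_nbhs_nbhs; split => //; exact: closed_openC.
by apply: filterS => r Ar; rewrite chi0// scale0r.
Qed.
End Bump.

Section UniformTopology.
Context (R : realType) (H : completeNormedModType R[i]) (X : topologicalType).
Implicit Types (S : set {uniform X -> H}) (f g : {uniform X -> H}).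

Lemma nbhs_uniformP f (B : set {uniform X -> H}) : nbhs f B <->
  exists2 e : R, 0 < e & forall g, (forall x, nr (g x - f x) < e) -> B g.
Proof.
split=> [/uniform_nbhs[E [/= entE EB]]|[e e0 eB]].
  move: entE; rewrite -entourage_ballE => -[_ /posC[e e0 ->] eE].
  exists e => // g gf; apply: EB => x _; apply: eE => /=.
  by rewrite -ball_normE/= norm_lt nrBC.
apply/uniform_nbhs; exists [set xy | ball xy.1 (e%:C)%C xy.2]; split.
  by rewrite -entourage_ballE; exists (e%:C)%C => //=; rewrite realC_gt0.
move=> g /= h; apply: eB => x; have := h x I.
by rewrite -ball_normE/= norm_lt nrBC.
Qed.

Lemma closure_uniformP S f : closure S f <->
  forall e : R, 0 < e -> exists2 g, S g & forall x, nr (g x - f x) < e.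
Proof.
split=> [Sf e e0|h B /nbhs_uniformP[e e0 eB]].
  have [|g [Sg gf]] := Sf [set g | forall x, nr (g x - f x) < e].
    by apply/nbhs_uniformP; exists e.
  by exists g.
by have [g Sg gf] := h e e0; exists g; split => //; exact: eB.
Qed.

Lemma closed_operator_uniform (T : operator {uniform X -> H}) :
  (forall f g, (forall e : R, 0 < e -> exists2 h, dom T h &
      (forall x, nr (h x - f x) < e) /\ (forall x, nr (T h x - g x) < e)) ->
    dom T f /\ T f = g) -> closed_operator T.
Proof.
move=> h [f g] fg; suff [Tf <-] : dom T f /\ T f = g by exists f.
apply: h => e e0.
have [|_ [[k Tk <-]] [/= kf kg]] := fg [set p | (forall x, nr (p.1 x - f x) < e)
    /\ (forall x, nr (p.2 x - g x) < e)].
  exists ([set k | forall x, nr (k x - f x) < e], [set k | forall x, nr (k x - g x) < e]).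
    by split; apply/nbhs_uniformP; exists e.
  by move=> [a b] [].
by exists k.
Qed.
End UniformTopology.

(** * Operators between the minimal and the maximal one *)

Lemma sqr_sum_lt (R : realType) (a b e : R) : 0 <= a -> 0 <= b ->
  a < e / 2 -> b < e / 2 -> a ^+ 2 + b ^+ 2 < e ^+ 2.
Proof. by move=> a0 b0 ae be; nra. Qed.

Section ModuleOperators.
Context (R : realType) (H : completeNormedModType R[i])
  (dot : {dot H for Num.conj}) (norm_dot : forall x, `|x| ^+ 2 = dot x x).
Context (D : operator H) (D_sym : closed_symmetric dot D)
    (D_def : deficiency_indices dot D 1 1)
    (phip phim : H)
    (phip_def : deficiency_space dot D 'i phip)
    (phim_def : deficiency_space dot D (- 'i) phim)
    (phip_norm : graph_norm dot (hadjoint dot D) phip = 1)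
    (phim_norm : graph_norm dot (hadjoint dot D) phim = 1)
    (X : topologicalType) (lcX : locally_compact [set: X])
    (T2X : hausdorff_space X).
Local Notation ip := (ip dot).
Local Notation Dm := (hadjoint dot D).
Local Notation alp := (graph_ip dot Dm phip).
Local Notation alm := (graph_ip dot Dm phim).
Local Notation module := (@module R H X).
Local Notation madjoint := (madjoint dot).
Local Notation TM := (@Tmax R H dot X D).
Implicit Types f g : {uniform X -> H}.

Let Dmlin : linear_operator Dm. Proof. exact: hadjoint_linear. Qed.

Lemma graph_norm_lt x (e : R) : 0 < e ->
  (graph_norm dot Dm x < (e%:C)%C) = (nr x ^+ 2 + nr (Dm x) ^+ 2 < e ^+ 2).
Proof.
move=> e0; rewrite /graph_norm /graph_ip !(ip_nr norm_dot) -rmorphD/=.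
set t := _ + _; have t0 : 0 <= t by rewrite addr_ge0// sqr_ge0.
have {1}-> : (e%:C)%C = sqrtC ((e ^+ 2)%:C)%C.
  by rewrite rmorphXn/= sqrCK// ler0c ltW.
by rewrite ltr_sqrtC ?nnegrE ?ler0c ?sqr_ge0// ltcR.
Qed.

(** Continuity and decay for the graph norm amount to those of f and of D^* f. *)
Lemma domTmaxP f : dom TM f <->
  [/\ forall x, dom Dm (f x), module f & module (fun x => Dm (f x))].
Proof.
have BE q p : dom Dm (f q) -> dom Dm (f p) -> Dm (f q - f p) = Dm (f q) - Dm (f p).
  by move=> Dq Dp; have [] := linear_domB Dmlin Dq Dp.
have sq (a b e : R) : 0 <= a -> 0 <= b -> 0 < e -> a ^+ 2 + b ^+ 2 < e ^+ 2 ->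
    a < e /\ b < e.
  move=> a0 b0 e0 h; have := sqr_ge0 a; have := sqr_ge0 b => h1 h2.
  by split; rewrite -(ltr_pXn2r (n:=2)) ?nnegrE// ?ltW//; lra.
split=> [[fD fc fv]|[fD /C0P[fc fv] /C0P[gc gv]]].
  have cE p (e : R) : 0 < e -> \forall q \near p, nr (f q - f p) < e /\
      nr (Dm (f q) - Dm (f p)) < e.
    move=> e0; have := fc p (e%:C)%C; rewrite realC_gt0 => /(_ e0).
    apply: filterS => q; rewrite graph_norm_lt// -BE// => h.
    by apply: sq => //; exact: nr_ge0.
  have vE (e : R) : 0 < e -> exists2 A : set X, compact A &
      forall x, ~ A x -> nr (f x) < e /\ nr (Dm (f x)) < e.
    move=> e0; have := fv (e%:C)%C; rewrite realC_gt0 => /(_ e0)[A cA hA].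
    exists A => // x /hA; rewrite graph_norm_lt// => h.
    by apply: sq => //; exact: nr_ge0.
  split=> //; apply/C0P; split.
  - by move=> p e e0; have := cE p e e0; apply: filterS => q [].
  - by move=> e e0; have [A cA hA] := vE e e0; exists A => // x /hA[].
  - by move=> p e e0; have := cE p e e0; apply: filterS => q [].
  - by move=> e e0; have [A cA hA] := vE e e0; exists A => // x /hA[].
split=> // [p _ /posC[e e0 ->]|_ /posC[e e0 ->]]; have e2 : 0 < e / 2 by lra.
  apply: filterS2 (fc p _ e2) (gc p _ e2) => q h1 h2.
  by rewrite graph_norm_lt// BE//; apply: sqr_sum_lt => //; exact: nr_ge0.
have [A cA hA] := fv _ e2; have [B cB hB] := gv _ e2.
exists (A `|` B); first exact: compactU.
move=> x /not_orP[/hA h1 /hB h2].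
by rewrite graph_norm_lt//; apply: sqr_sum_lt => //; exact: nr_ge0.
Qed.

Lemma ncont_ip (phi : H) (f : X -> H) p :
  ncont f p -> ncont (fun x => ip phi (f x) : R[i]^o) p.
Proof.
apply: (ncont_lip (W := R[i]^o) (A := fun z => ip phi z) (C := nr phi + 1)).
  by rewrite ltr_wpDl// nr_ge0.
move=> y z; rewrite -ipBr.
apply: le_trans (cauchy_schwarz norm_dot _ _) _.
by rewrite ler_wpM2r ?nr_ge0// lerDl.
Qed.

Lemma ncont_alpha f p : dom TM f ->
  ncont (fun x => alp (f x) : R[i]^o) p /\ ncont (fun x => alm (f x) : R[i]^o) p.
Proof.
move=> /domTmaxP[fD /C0P[fc _] /C0P[gc _]].
have h phi : ncont (fun x => graph_ip dot Dm phi (f x) : R[i]^o) p.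
  by apply: (ncontD (V := R[i]^o)); apply: ncont_ip.
by split; exact: h.
Qed.

Lemma Tmax_linear a f g : dom TM f -> dom TM g ->
  dom TM (fun x => a *: f x + g x : H) /\
  (forall x, Dm (a *: f x + g x) = a *: Dm (f x) + Dm (g x)).
Proof.
move=> /domTmaxP[fD fm fm'] /domTmaxP[gD gm gm'].
have E x : dom Dm (a *: f x + g x) /\ Dm (a *: f x + g x) = a *: Dm (f x) + Dm (g x).
  exact: Dmlin.2.
have sc (h : X -> H) : C0 setT (fun v : H => `|v|) h ->
    C0 setT (fun v : H => `|v|) (fun x => a *: h x).
  apply: (C0_lip (A := fun v => a *: v) (C := nr a + 1)).
  - by rewrite ltr_wpDl// nr_ge0.
  - by move=> y z; rewrite -scalerBr nrZ ler_wpM2r ?nr_ge0// lerDl.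
  - by rewrite scaler0.
split=> [|x]; last by have [] := E x.
apply/domTmaxP; split=> [x||]; first by have [] := E x.
- by apply: C0_D => //; exact: sc.
- rewrite (_ : (fun x => _) = (fun x => a *: Dm (f x) + Dm (g x))).
    by apply: C0_D => //; exact: sc.
  by apply/funext => x; have [] := E x.
Qed.

Lemma Tmax_act (a : X -> R[i]) f :
  C0 setT (fun z : R[i] => `|z|) a -> dom TM f ->
  dom TM (module_act a f) /\ (forall x, Dm (a x *: f x) = a x *: Dm (f x)).
Proof.
move=> aC /domTmaxP[fD fm fm'].
have E x : Dm (a x *: f x) = a x *: Dm (f x) by have [] := linear_domZ Dmlin (a x) (fD x).
split=> //; apply/domTmaxP; split=> [x||].
- by have [] := linear_domZ Dmlin (a x) (fD x).
- exact: C0_Z.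
- rewrite (_ : (fun x => _) = (fun x => a x *: Dm (f x))); first exact: C0_Z.
  by apply/funext.
Qed.

Lemma Tmax_closed f g :
  (forall e : R, 0 < e -> exists2 h, dom TM h &
     (forall x, nr (h x - f x) < e) /\ (forall x, nr (Dm (h x) - g x) < e)) ->
  dom TM f /\ (forall x, Dm (f x) = g x).
Proof.
move=> H0.
have E x : dom Dm (f x) /\ Dm (f x) = g x.
  apply: closed_operatorP; first exact: hadjoint_closed.
  move=> e e0; have [h /domTmaxP[hD _ _] [h1 h2]] := H0 e e0.
  by exists (h x).
split=> [|x]; last by have [] := E x.
apply/domTmaxP; split=> [x||]; first by have [] := E x.
- apply: C0_closed => e e0; have [h /domTmaxP[_ hm _] [h1 _]] := H0 e e0.
  by exists h.
- apply: C0_closed => e e0; have [h /domTmaxP[_ _ hm] [_ h2]] := H0 e e0.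
  by exists (fun x => Dm (h x)); split => // x; have [_ ->] := E x.
Qed.

Lemma domTmax_bump (chi : X -> R[i]^o) (A U : set X) (v : X -> H) :
  (forall q, ncont chi q) -> A `<=` U -> compact A /\ closed A ->
  (forall q, ~ A q -> chi q = 0) -> (forall q, dom Dm (v q)) ->
  (forall q, U q -> ncont v q) -> (forall q, U q -> ncont (fun x => Dm (v x)) q) ->
  dom TM (fun x => chi x *: v x).
Proof.
move=> chic AU [cA clA] chi0 vD vc Dvc.
apply/domTmaxP; split=> [x||].
- by have [] := linear_domZ Dmlin (chi x) (vD x).
- exact: (bump_C0 chic AU).
- rewrite (_ : (fun x => _) = (fun x => chi x *: Dm (v x))).
    exact: (bump_C0 chic AU).
  by apply/funext => x; have [] := linear_domZ Dmlin (chi x) (vD x).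
Qed.

(** Elements of dom Tmax with prescribed boundary values near p; they serve to
   test the adjoint and to compare dom T_Lambda with that of its adjoint. *)
Lemma bump_phi (a b : X -> R[i]^o) (U : set X) p : open U -> U p ->
  (forall q, U q -> ncont a q) -> (forall q, U q -> ncont b q) ->
  exists (f : {uniform X -> H}) (chi : X -> R[i]^o),
    [/\ dom TM f, chi p = 1, forall q, ~ U q -> chi q = 0,
      forall q, alp (f q) = chi q * a q & forall q, alm (f q) = chi q * b q].
Proof.
move=> oU Up ac bc; have [chi [A [chic chi1 AU cA chi0]]] := bump R lcX T2X oU Up.
have [pD pE] := phip_def; have [mD mE] := phim_def.
pose v x := a x *: phip + b x *: phim.
have vP x : dom Dm (v x) /\ Dm (v x) = a x *: ('i *: phip) + b x *: (- 'i *: phim).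
  have [D1 E1] := linear_domZ Dmlin (a x) pD; have [D2 E2] := linear_domZ Dmlin (b x) mD.
  by have [D3 E3] := linear_domD Dmlin D1 D2; rewrite E3 E1 E2 pE mE.
exists (fun x => chi x *: v x), chi; split => //.
- apply: (domTmax_bump chic AU cA chi0).
  + by move=> q; have [] := vP q.
  + move=> q Uq; apply: ncontD; apply: ncontZ; by [exact: ac|exact: bc|exact: ncont_cst].
  + move=> q Uq; rewrite (_ : (fun x => _) = fun x => a x *: ('i *: phip) + b x *: (- 'i *: phim)).
      apply: ncontD; apply: ncontZ; by [exact: ac|exact: bc|exact: ncont_cst].
    by apply/funext => x; have [] := vP x.
- by move=> q Uq; apply: chi0 => /AU.
- move=> q; have [vD _] := vP q; rewrite (graph_ipZ norm_dot D_sym)//.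
  have [D1 _] := linear_domZ Dmlin (a q) pD; have [D2 _] := linear_domZ Dmlin (b q) mD.
  rewrite (graph_ipD norm_dot D_sym)// !(graph_ipZ norm_dot D_sym)//.
  by rewrite (alp_phip phip_norm) (alp_phim phip_def phim_def) mulr1 mulr0 addr0.
- move=> q; have [vD _] := vP q; rewrite (graph_ipZ norm_dot D_sym)//.
  have [D1 _] := linear_domZ Dmlin (a q) pD; have [D2 _] := linear_domZ Dmlin (b q) mD.
  rewrite (graph_ipD norm_dot D_sym)// !(graph_ipZ norm_dot D_sym)//.
  by rewrite (alm_phim phim_norm) (alm_phip phip_def phim_def) mulr1 mulr0 add0r.
Qed.

(** (1 + s^2 D^* D)^-1 tends to 1 strongly as s tends to 0, uniformly on compact
   sets, and f has small values outside a compact set; it takes f to g. *)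
Lemma C0_domD_dense f (e : R) : module f -> 0 < e ->
  exists2 g, dom TM g & (forall x, dom D (g x)) /\ forall x, nr (g x - f x) < e.
Proof.
move=> fm e0; have [fc fv] := (C0P f).1 fm.
have [Dlin Ddense _ _] := D_sym.
have d0 : 0 < e / 2 by rewrite divr_gt0.
have [A cA hA] := fv _ d0.
(* one s is small enough for all points of A, by compactness *)
have [s s0 sA] : exists2 s : R, 0 < s & forall x, A x -> exists z,
    [/\ dom D z, nr (f x - z) < e / 2 & s * nr (D z) < e / 2].
  have := (compact_near_coveringP A).1 cA R (0 : R)^'+ (fun s x => exists z,
    [/\ dom D z, nr (f x - z) < e / 2 & s * nr (D z) < e / 2]).
  move=> /(_ _)/=; case.
    move=> x _; have [z Dz zx] := dense_nr Ddense (f x) d0.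
    have t0 : 0 < e / 2 / (nr (D z) + 1) by rewrite divr_gt0// ltr_wpDl ?nr_ge0.
    have g0 : 0 < e / 2 - nr (f x - z) by rewrite subr_gt0 nrBC.
    exists ([set q | nr (f q - f x) < e / 2 - nr (f x - z)],
        [set s : R | 0 < s /\ s < e / 2 / (nr (D z) + 1)]).
      split; first exact: fc.
      by apply: filterI; [exact: nbhs_right_gt|exact: nbhs_right_lt].
    move=> [q s] [/= fq [s0 st]]; exists z; split => //.
      rewrite (_ : f q - z = (f q - f x) + (f x - z)); last by rewrite subrKA.
      by apply: le_lt_trans (nrD _ _) _; rewrite -ltrBrDr.
    apply: le_lt_trans (_ : s * (nr (D z) + 1) < _).
      by rewrite ler_wpM2l ?lerDl// ltW.
    by rewrite -ltr_pdivlMr// ltr_wpDl ?nr_ge0.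
  move=> t /= t0 ht; have t2 : 0 < t / 2 by rewrite divr_gt0.
  exists (t / 2) => //; apply: (ht (t / 2)) => //=.
  by rewrite sub0r normrN gtr0_norm// ltr_pdivrMr// ltr_pMr// ltrDl.
have sD := scale_op_symmetric D_sym s0.
pose A_ := resolvent norm_dot sD.
have [A0 DA0] := resolvent0 norm_dot sD; rewrite -/A_ in A0 DA0.
have lipA y z : nr (A_ y - A_ z) <= 1 * nr (y - z).
  by rewrite mul1r; exact: (resolvent_lipschitz norm_dot sD y z).1.
have domA y : dom D (A_ y) by have [] := resolventP norm_dot sD y.
have unscale y : D y = ((s^-1)%:C)%C *: ((s%:C)%C *: D y).
  rewrite scalerA -rmorphM/= mulVf ?gt_eqF//.
  by rewrite (_ : (1%:C)%C = 1)// scale1r.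
have lipDA y z : nr (D (A_ y) - D (A_ z)) <= s^-1 * nr (y - z).
  rewrite (unscale (A_ y)) (unscale (A_ z)) -scalerBr nrZ nrR.
  rewrite gtr0_norm ?invr_gt0//; apply: ler_wpM2l; first by rewrite invr_ge0 ltW.
  exact: (resolvent_lipschitz norm_dot sD y z).2.
have DmA y : dom Dm (A_ y) /\ Dm (A_ y) = D (A_ y).
  exact: hadjoint_ext.
exists (A_ \o f); last first.
  split=> [x|x]; first exact: domA.
  have near z : dom D z -> nr (f x - z) < e / 2 -> s * nr (D z) < e / 2 ->
      nr (A_ (f x) - f x) < e.
    move=> Dz h1 h2; have := resolvent_approx norm_dot sD (f x) (z := z) Dz.
    rewrite -/A_ /= nrZ nrR gtr0_norm// nrBC => h.
    rewrite -(ltr_pXn2r (n:=2)) ?nnegrE ?nr_ge0 ?ltW//.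
    have p1 := nr_ge0 (f x - z).
    have p2 : 0 <= s * nr (D z) by rewrite mulr_ge0 ?nr_ge0 ?ltW.
    by apply: le_lt_trans h _; exact: sqr_sum_lt.
  have [Ax|/hA Ax] := pselect (A x); last first.
    apply: (near 0); first exact: Dlin.1.
      by rewrite subr0.
    by rewrite (linear_op0 Dlin) nr0 mulr0.
  by have [z [Dz xz sz]] := sA _ Ax; exact: (near z).
apply/domTmaxP; split=> [x||].
- by have [] := DmA (f x).
- exact: (C0_lip ltr01 lipA A0).
- rewrite (_ : (fun x => _) = (fun y => D (A_ y)) \o f).
    apply: (C0_lip _ lipDA) => //; first by rewrite invr_gt0.
    by rewrite unscale [X in _ *: X]DA0 scaler0.
  by apply/funext => x /=; have [] := DmA (f x).
Qed.

(** Restrictions of Tmax that are defined on all functions with zero boundary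
   values, i.e. operators given by a boundary condition. Passing to the adjoint
   preserves this class. *)
Definition boundary_restriction (S : operator {uniform X -> H}) : Prop :=
  [/\ dom S `<=` dom TM, forall f, dom S f -> S f = TM f &
    forall f, dom TM f -> (forall x, alp (f x) = 0 /\ alm (f x) = 0) -> dom S f].

(** Testing with bump functions times y in dom D shows that z is D^* g at every
   point. *)
Lemma adjoint_values_Tmax S g z : boundary_restriction S ->
  adjoint_values module (@module_ip R H dot X) S g z ->
  forall x, dom Dm (g x) /\ Dm (g x) = z x.
Proof.
move=> [ST SE S0] [zm gz] p; apply/hadjointP => // y Dy.
have [chi [A [chic chi1 AU cA chi0]]] := bump R lcX T2X openT (I : setT p).
have [yD yE] := hadjoint_ext norm_dot D_sym Dy.
have fT : dom TM (fun x => chi x *: y).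
  by apply: (domTmax_bump chic AU cA chi0) => // q _; exact: ncont_cst.
have [a1 a2] := alpha_dom norm_dot D_sym phip_def phim_def Dy.
have Sf : dom S (fun x => chi x *: y).
  by apply: S0 => // x; rewrite !(graph_ipZ norm_dot D_sym)// a1 a2 !mulr0.
have := congr1 (fun h => h p) (gz _ Sf); rewrite SE// => E.
have : ip (Dm (chi p *: y)) (g p) = ip (chi p *: y) (z p) := E.
by rewrite chi1 scale1r yE.
Qed.

(** The functions with zero boundary values force g to be in dom Tmax; Green's
   formula then says what the other elements of dom S require of g. *)
Lemma madjointP S g : boundary_restriction S ->
  dom (madjoint S) g <-> dom TM g /\ forall f, dom S f -> forall x,
    (alp (f x))^* * alp (g x) = (alm (f x))^* * alm (g x).
Proof.
move=> bS; have [ST SE S0] := bS; split.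
  move=> [gm [z [zm gz]]].
  have gzE := adjoint_values_Tmax bS (conj zm gz).
  have gT : dom TM g.
    apply/domTmaxP; split=> [x|//|]; first by have [] := gzE x.
    rewrite (_ : (fun x => _) = z)//; by apply/funext => x; have [] := gzE x.
  split=> // f Sf x; have [fD _ _] := (domTmaxP f).1 (ST _ Sf).
  have := congr1 (fun h => h x) (gz _ Sf); rewrite SE// => E.
  have : ip (Dm (f x)) (g x) = ip (f x) (z x) := E.
  have [gD <-] := gzE x => /eqP; rewrite -subr_eq0.
  rewrite (boundary_form norm_dot D_sym D_def phip_def phim_def phip_norm phim_norm)//.
  rewrite mulf_eq0 oppr_eq0 (negPf (neq0Ci _))/= subr_eq0.
  by move/eqP.
move=> [gT h]; have [gD gm Dgm] := (domTmaxP g).1 gT.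
split=> //; exists (fun x => Dm (g x)); split => // f Sf.
have [fD _ _] := (domTmaxP f).1 (ST _ Sf).
rewrite SE//; apply/funext => x.
change (ip (Dm (f x)) (g x) = ip (f x) (Dm (g x))).
apply/eqP; rewrite -subr_eq0.
rewrite (boundary_form norm_dot D_sym D_def phip_def phim_def phip_norm phim_norm)//.
by rewrite h// subrr mulr0.
Qed.

Lemma madjointE S g : boundary_restriction S -> dom (madjoint S) g ->
  madjoint S g = TM g.
Proof.
move=> bS gS; have [gm [z0 vz0]] := gS.
have := xgetPex 0 (ex_intro _ z0 vz0).
rewrite -/(madjoint S g) => v; apply/funext => x.
by have [_ E] := adjoint_values_Tmax bS v x; rewrite -[LHS]E.
Qed.

Lemma madjoint_boundary_restriction S : boundary_restriction S ->
  boundary_restriction (madjoint S).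
Proof.
move=> bS; split.
- by move=> g /(madjointP _ bS)[].
- by move=> g; exact: madjointE.
- move=> g gT g0; apply/(madjointP _ bS); split => // f _ x.
  by have [-> ->] := g0 x; rewrite !mulr0.
Qed.

Lemma boundary_restriction_dense S : boundary_restriction S -> mdense (dom S).
Proof.
move=> [_ _ S0] f fm; apply/closure_uniformP => e e0.
have [g gT [gD gf]] := C0_domD_dense fm e0; exists g => //.
by apply: S0 => // x; exact: (alpha_dom norm_dot D_sym phip_def phim_def).
Qed.

End ModuleOperators.

(** * Invariance under equality of operators *)

Section OperatorEquality.
Context (R : realType) (H : completeNormedModType R[i])
  (dot : {dot H for Num.conj}) (X : topologicalType).
Implicit Types S T : operator {uniform X -> H}.
Local Notation madjoint := (madjoint dot).

Lemma madjoint_op_eq S T : op_eq S T -> madjoint S = madjoint T.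
Proof.
move=> [dE E].
suff V : adjoint_values (@module R H X) (@module_ip R H dot X) S =
         adjoint_values (@module R H X) (@module_ip R H dot X) T.
  by rewrite /Defs.madjoint /adjoint V.
apply/funext => g; apply/seteqP; split=> z [zm h]; split => // f fD.
  by rewrite -E// h// dE.
by rewrite E ?h// -dE.
Qed.

Lemma semiregular_op_eq S T : op_eq S T -> semiregular dot T -> semiregular dot S.
Proof.
move=> ST [[m1 m2 [l0 l] m4] d d']; have [dE E] := ST.
split; last 2 first.
- by rewrite dE.
- by rewrite (madjoint_op_eq ST).
split; rewrite ?dE //.
- by move=> f fT; rewrite E//; exact: m2.
- split=> [|a f g]; rewrite dE// => fT gT; have [h1 h2] := l a f g fT gT.
  by split => //; rewrite !E.
- move=> a f aC fT; have [h1 h2] := m4 a f aC fT.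
  by split => //; rewrite !E.
Qed.

Lemma selfadjoint_op_eq S T : op_eq S T -> selfadjoint dot T -> selfadjoint dot S.
Proof.
move=> ST [sT [dT ET]]; split; first exact: semiregular_op_eq ST sT.
have [dE E] := ST; rewrite (madjoint_op_eq ST).
by split; [rewrite dE|move=> f fS; rewrite E ?ET// dT].
Qed.

Lemma regular_op_eq S T : op_eq S T -> regular dot T -> regular dot S.
Proof.
move=> ST [cT sT d]; have [dE E] := ST; split.
- move: cT; rewrite /closed_operator.
  suff -> : [set (f, S f) | f in dom S] = [set (f, T f) | f in dom T] by [].
  apply/seteqP; split => _ [f fS <-]; exists f => //; first by rewrite -dE.
  + by rewrite E// -dE.
  + by rewrite dE.
  + by rewrite E.
- exact: semiregular_op_eq ST sT.
- rewrite (madjoint_op_eq ST).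
  apply: subset_trans d _; apply: closureS => _ [f [fT Tf] <-].
  by exists f; [split; rewrite ?dE// E|rewrite E].
Qed.
End OperatorEquality.

(** * The singular support *)

Section SingularSupportFacts.
Context (R : realType) (X : topologicalType) (Lambda : X -> R[i]^o).

Lemma within_ncont (U : set X) (L : X -> R[i]^o) : open U ->
  {within U, continuous L} <-> (forall q, U q -> ncont L q).
Proof.
move=> oU; rewrite continuous_open_subspace//; split=> h q.
  by move=> Uq; apply/ncontP; apply: h; rewrite inE.
by rewrite inE => Uq; apply/ncontP; exact: h.
Qed.

Lemma reg_ncont p : reg Lambda p -> ncont Lambda p.
Proof. by move=> [U [oU Up] /(within_ncont _ oU)]; exact. Qed.

Lemma reg_open : open (reg Lambda).
Proof.
rewrite openE => p [U [oU Up] cU]; apply: (filterS _ (open_nbhs_nbhs (conj oU Up))).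
by move=> q Uq; exists U.
Qed.

Lemma ssupp_closed : closed (ssupp Lambda).
Proof. exact: open_closedC reg_open. Qed.

Lemma continuous_ssupp : continuous Lambda <-> ssupp Lambda = set0.
Proof.
split=> [c|s0 p].
  rewrite -subset0 => p np; apply: np; exists setT.
    by split => //; exact: openT.
  by apply/within_ncont => [|q _]; [exact: openT|apply/ncontP; exact: c].
apply/(ncontP (V := R[i]^o)); apply: reg_ncont; apply: contrapT => np.
by have : ssupp Lambda p by []; rewrite s0.
Qed.

Lemma reg_oo_reg p : reg_oo Lambda p -> closure (reg Lambda) p /\ ssupp Lambda p.
Proof.
move=> [[cp np] _]; split => // rp; apply: np; apply: open_nbhs_nbhs.
by split => //; exact: reg_open.
Qed.

Lemma closure_reg p : ~ (ssupp Lambda)° p -> closure (reg Lambda) p.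
Proof.
move=> np B pB; apply: contrapT => h; apply: np; apply: filterS pB => q Bq rq.
by apply: h; exists q.
Qed.

Lemma Lambda_tilde_reg p : reg Lambda p -> Lambda_tilde Lambda p = Lambda p.
Proof. by move=> rp; rewrite /Lambda_tilde mem_set. Qed.

Hypothesis ssupp_reg_oo : ssupp Lambda = reg_oo Lambda.

(** Near any point Lambda_tilde is a continuous function that extends Lambda; at
   a point of reg_oo the limit along reg is computed with this function. *)
Lemma Lambda_tilde_local p : exists U (L : X -> R[i]^o),
  [/\ open_nbhs p U, forall q, U q -> ncont L q,
      forall q, U q -> reg Lambda q -> L q = Lambda q &
      forall q, U q -> Lambda_tilde Lambda q = L q].
Proof.
have [rp|np] := pselect (reg Lambda p).
  exists (reg Lambda), Lambda; split => //.
  - by split => //; exact: reg_open.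
  - by move=> q; exact: reg_ncont.
  - by move=> q; exact: Lambda_tilde_reg.
have : reg_oo Lambda p by rewrite -ssupp_reg_oo.
move=> [_ [U [L [[oU Up] cL _ LL]]]]; have {}cL := (within_ncont L oU).1 cL.
exists U, L; split => // q Uq.
have [rq|nq] := pselect (reg Lambda q); first by rewrite Lambda_tilde_reg// LL.
have [cq _] : closure (reg Lambda) q /\ ssupp Lambda q.
  by apply: reg_oo_reg; rewrite -ssupp_reg_oo.
rewrite /Lambda_tilde memNset//.
have PF : ProperFilter (within (reg Lambda) (nbhs q)).
  exact: within_nbhs_proper.
apply: cvg_lim; first exact: norm_hausdorff.
have /(ncontP (V := R[i]^o)) Lc := cL q Uq.
move=> B LB; change (\forall r \near q, reg Lambda r -> B (Lambda r)).
apply: filterS2 (open_nbhs_nbhs (conj oU Uq)) (Lc B LB) => r Ur Br rr.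
by rewrite -LL.
Qed.

Lemma Lambda_tilde_continuous : continuous (Lambda_tilde Lambda).
Proof.
move=> p; have [U [L [oU cL _ tL]]] := Lambda_tilde_local p.
apply/(ncontP (V := R[i]^o)); apply: (ncont_near (f := L)); last by apply: cL; case: oU.
by have := open_nbhs_nbhs oU; apply: filterS => q Uq; rewrite tL.
Qed.

End SingularSupportFacts.

(** * The operator T_Lambda and its adjoint *)

Section TLambdaFacts.
Context (R : realType) (H : completeNormedModType R[i])
  (dot : {dot H for Num.conj}) (norm_dot : forall x, `|x| ^+ 2 = dot x x).
Context (D : operator H) (D_sym : closed_symmetric dot D)
    (D_def : deficiency_indices dot D 1 1)
    (phip phim : H)
    (phip_def : deficiency_space dot D 'i phip)
    (phim_def : deficiency_space dot D (- 'i) phim)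
    (phip_norm : graph_norm dot (hadjoint dot D) phip = 1)
    (phim_norm : graph_norm dot (hadjoint dot D) phim = 1)
    (X : topologicalType) (lcX : locally_compact [set: X])
    (T2X : hausdorff_space X).
Local Notation ip := (ip dot).
Local Notation Dm := (hadjoint dot D).
Local Notation alp := (graph_ip dot Dm phip).
Local Notation alm := (graph_ip dot Dm phim).
Local Notation module := (@module R H X).
Local Notation madjoint := (madjoint dot).
Local Notation TM := (@Tmax R H dot X D).
Local Notation bres := (@boundary_restriction R H dot D phip phim X).
Implicit Types f g : {uniform X -> H}.

Let Dmlin : linear_operator Dm. Proof. exact: hadjoint_linear. Qed.

(** A dense subset of the module cannot have values at p inside the proper
   closed cone on which ip phip and ip phim have equal absolute values. *)
Lemma mdense_separate (S : set {uniform X -> H}) p : mdense S ->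
  (forall k, S k -> nr (ip phip (k p)) = nr (ip phim (k p))) -> False.
Proof.
move=> dS SE.
have [h hN] := ip_phi_separate norm_dot D_sym phip_def phim_def phip_norm phim_norm.
apply: hN.
have [chi [A [chic chi1 AU [cA clA] chi0]]] := bump R lcX T2X openT (I : setT p).
have Fm : module (fun x => chi x *: h).
  by apply: (bump_C0 chic AU) => // q _; exact: ncont_cst.
have near (e : R) : 0 < e -> `|nr (ip phip h) - nr (ip phim h)| <= (nr phip + nr phim) * e.
  move=> e0; have [k Sk kF] := (closure_uniformP _ _).1 (dS _ Fm) e e0.
  have := kF p; rewrite chi1 scale1r => kh.
  have lip phi : `|nr (ip phi (k p)) - nr (ip phi h)| <= nr phi * e.
    have b : nr (ip phi (k p) - ip phi h) <= nr phi * e.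
      rewrite -ipBr; apply: le_trans (cauchy_schwarz norm_dot _ _) _.
      by rewrite ler_wpM2l ?nr_ge0// ltW.
    have h1 := nrD (ip phi (k p) - ip phi h) (ip phi h).
    have h2 := nrB (ip phi (k p)) (ip phi (k p) - ip phi h).
    rewrite subrK in h1; rewrite subKr in h2.
    by rewrite ler_norml; apply/andP; split; lra.
  have := lip phip; have := lip phim; rewrite SE// !ler_norml => /andP[a1 a2] /andP[b1 b2].
  by apply/andP; split; lra.
apply/eqP; rewrite -subr_eq0 -normr_le0; apply/ler_addgt0Pr => e e0; rewrite add0r.
have c0 : 0 < nr phip + nr phim + 1 by rewrite ltr_wpDl// addr_ge0// nr_ge0.
apply: le_trans (near _ (divr_gt0 e0 c0)) _.
rewrite mulrA ler_pdivrMr// mulrC ler_wpM2l ?ltW// ltrDl//.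
Qed.

Lemma nr_conjM (a b : R[i]) : a^* * a = b^* * b -> nr a = nr b.
Proof.
move=> /(congr1 (@nr R _)); rewrite !nrM !nr_conj -!expr2 => h.
by apply/eqP; rewrite -(eqrXn2 (n:=2)) ?nr_ge0// h.
Qed.

Section WithLambda.
Context (Lambda : X -> R[i]^o) (Lambda_S1 : forall x, `|Lambda x| = 1).
Local Notation T := (TLambda dot D phip phim Lambda).
Local Notation reg := (reg Lambda).
Local Notation ssupp := (ssupp Lambda).

Lemma Lambda_conj x : (Lambda x)^* * Lambda x = 1.
Proof. by rewrite mulrC -normCK Lambda_S1 expr1n. Qed.

Lemma T_boundary : bres T.
Proof.
split=> [f [] //|//|f fT f0]; split => // x.
by have [-> ->] := f0 x; rewrite mulr0.
Qed.

Lemma T_adj_boundary : bres (madjoint T).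
Proof. exact: (madjoint_boundary_restriction norm_dot D_sym _ _ _ _ _ lcX T2X T_boundary). Qed.

(** At a point where alpha_- does not vanish, Lambda = alpha_+ / alpha_- is
   continuous. *)
Lemma T_ssupp f p : dom T f -> ssupp p -> alp (f p) = 0 /\ alm (f p) = 0.
Proof.
move=> [fT fL] sp.
suff m0 : alm (f p) = 0 by split => //; rewrite fL m0 mulr0.
apply: contrapT => /eqP m0; apply: sp.
have cont q := ncont_alpha norm_dot D_sym phip phim q fT.
pose U := [set q | alm (f q) != 0].
have oU : open U.
  rewrite openE => q Uq; have [_ c] := cont q.
  exact: (ncont_neq0 (V := R[i]^o) c).
exists U; first by split.
apply/(within_ncont _ oU) => q Uq; have [c1 c2] := cont q.
apply: (ncont_near (f := fun x => alp (f x) * (alm (f x))^-1 : R[i]^o)); last first.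
  by apply: ncontM => //; exact: ncontV.
have := open_nbhs_nbhs (conj oU Uq); apply: filterS => r Ur.
by rewrite fL mulfK.
Qed.

(** Elements of dom T with boundary values (Lambda, 1) at a regular point force
   the condition there; elsewhere all elements of dom T have boundary values
   zero and there is no condition. *)
Lemma T_adj_dom g : dom (madjoint T) g <->
  dom TM g /\ forall x, reg x -> alp (g x) = Lambda x * alm (g x).
Proof.
rewrite (madjointP norm_dot D_sym D_def phip_def phim_def phip_norm phim_norm lcX T2X _ T_boundary).
split=> [[gT h]|[gT h]]; split => //.
  move=> x rx.
  have [f [chi [fT chi1 chi0 fp fm]]] := bump_phi norm_dot D_sym phip_def
    phim_def phip_norm phim_norm lcX T2X (reg_open Lambda) rx
    (a := Lambda) (b := fun=> 1) (fun q rq => reg_ncont rq) (fun q _ => ncont_cst _ _).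
  have fS : dom T f by split => // q; rewrite fp fm mulr1 mulrC.
  have := h f fS x; rewrite fp fm chi1 !mul1r rmorph1 mul1r => <-.
  by rewrite mulrA [Lambda x * _]mulrC Lambda_conj mul1r.
move=> f fS x; have [rx|nx] := pselect (reg x).
  have [_ fL] := fS; rewrite h// fL rmorphM/= mulrACA.
  by rewrite Lambda_conj mul1r.
by have [-> ->] := T_ssupp fS nx; rewrite rmorph0 !mul0r.
Qed.

Lemma T_sub_adj f : dom T f -> dom (madjoint T) f.
Proof. by move=> [fT fL]; apply/T_adj_dom; split. Qed.

Lemma T_adjE f : dom (madjoint T) f -> madjoint T f = TM f.
Proof. exact: (madjointE norm_dot D_sym _ _ lcX T2X T_boundary). Qed.

Lemma T_adj_closure g p : dom (madjoint T) g -> closure reg p ->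
  nr (alp (g p)) = nr (alm (g p)).
Proof.
move=> /T_adj_dom[gT gL] cp; apply: nr_conjM.
have [c1 c2] := ncont_alpha norm_dot D_sym phip phim p gT.
apply: (ncont_closure_eq (V := R[i]^o)
  (f := fun x => (alp (g x))^* * alp (g x)) (g := fun x => (alm (g x))^* * alm (g x))
  (S := reg)) => //.
- by apply: ncontM => //; exact: ncont_conj.
- by apply: ncontM => //; exact: ncont_conj.
- move=> q rq; rewrite gL// rmorphM/= mulrACA.
  by rewrite Lambda_conj mul1r.
Qed.

Lemma T_closed : closed_operator T.
Proof.
apply: closed_operator_uniform => f g h.
have [|fT fg] := Tmax_closed norm_dot D_sym (f := f) (g := g).
  move=> e e0; have [k [kT _] [k1 k2]] := h e e0; exists k => //.
have fgE : TM f = g by apply/funext.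
split=> //; split => // x.
have [fD _ _] := (domTmaxP norm_dot D_sym f).1 fT.
apply/eqP; rewrite -subr_eq0; apply/eqP; apply: nr_eq0; apply/eqP.
rewrite eq_le nr_ge0 andbT; apply/ler_addgt0Pr => e e0; rewrite add0r.
pose c := nr phip * 2 + nr phim * 2 + 1.
have c0 : 0 < c by rewrite ltr_wpDl// addr_ge0// mulr_ge0// nr_ge0.
have [k [kT kL] [k1 k2]] := h _ (divr_gt0 e0 c0).
have [kD _ _] := (domTmaxP norm_dot D_sym k).1 kT.
have [dD dE] := linear_domB Dmlin (kD x) (fD x).
have le phi : nr (ip phi (k x - f x)) + nr (ip phi (Dm (k x - f x)))
    <= nr phi * 2 * (e / c).
  have a1 := cauchy_schwarz norm_dot phi (k x - f x).
  have a2 := cauchy_schwarz norm_dot phi (Dm (k x - f x)).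
  have a3 : nr phi * nr (k x - f x) <= nr phi * (e / c).
    by rewrite ler_wpM2l ?nr_ge0// ltW.
  have a4 : nr phi * nr (Dm (k x - f x)) <= nr phi * (e / c).
    by rewrite ler_wpM2l ?nr_ge0// dE (fg x); exact: ltW (k2 x).
  lra.
have lep : nr (alp (k x - f x)) <= nr phip * 2 * (e / c).
  rewrite (alpE phip_def); apply: le_trans (nrB _ _) _.
  by rewrite nrM nr_i mul1r.
have lem : nr (alm (k x - f x)) <= nr phim * 2 * (e / c).
  rewrite (almE phim_def); apply: le_trans (nrD _ _) _.
  by rewrite nrM nr_i mul1r.
have aB phi : graph_ip dot Dm phi (k x) =
    graph_ip dot Dm phi (k x - f x) + graph_ip dot Dm phi (f x).
  by rewrite -(graph_ipD norm_dot D_sym) ?subrK.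
have -> : alp (f x) - Lambda x * alm (f x) =
    Lambda x * alm (k x - f x) - alp (k x - f x).
  by have := kL x; rewrite !aB => /(canRL (addKr _)) ->; ring.
apply: le_trans (nrB _ _) _.
rewrite nrM (nr_eqE (Lambda_S1 x : _ = (1%:C)%C)) mul1r.
have : (nr phip * 2 + nr phim * 2 + 1) * (e / c) = e.
  by rewrite -/c; field; rewrite gt_eqF.
have : 0 < e / c by rewrite divr_gt0.
by move: (e / c) lep lem => t; lra.
Qed.

Lemma T_module_operator : module_operator T.
Proof.
have zT : dom TM (0 : {uniform X -> H}).
  have [D0 _] := Dmlin.
  have z : module (0 : {uniform X -> H}).
    apply/C0P; split=> [p|e e0]; first exact: ncont_cst.
    by exists set0 => [|x _]; [exact: compact0|rewrite nr0].
  apply/(domTmaxP norm_dot D_sym); split=> //.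
  rewrite (_ : (fun x => _) = (0 : {uniform X -> H}))//.
  by apply/funext => x; exact: linear_op0.
split.
- by move=> f [/(domTmaxP norm_dot D_sym)[]].
- by move=> f [/(domTmaxP norm_dot D_sym)[]].
- split.
    split => // x; have [D0 _] := Dmlin.
    by rewrite -[(0 : {uniform X -> H}) x](scale0r (0 : H))
      !(graph_ipZ norm_dot D_sym)// !mul0r mulr0.
  move=> a f g [fT fL] [gT gL].
  have [T1 T2] := Tmax_linear norm_dot D_sym a fT gT.
  have [fD _ _] := (domTmaxP norm_dot D_sym f).1 fT.
  have [gD _ _] := (domTmaxP norm_dot D_sym g).1 gT.
  split; last by apply/funext => x; exact: T2.
  split=> // x; have [aD _] := linear_domZ Dmlin a (fD x).
  rewrite [alp _](graph_ipD norm_dot D_sym phip aD (gD x)).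
  rewrite [alm _](graph_ipD norm_dot D_sym phim aD (gD x)).
  by rewrite !(graph_ipZ norm_dot D_sym)// fL gL; ring.
- move=> a f aC [fT fL].
  have [T1 T2] := Tmax_act norm_dot D_sym aC fT.
  have [fD _ _] := (domTmaxP norm_dot D_sym f).1 fT.
  split; last by apply/funext => x; exact: T2.
  split=> // x; rewrite /module_act !(graph_ipZ norm_dot D_sym)// fL; ring.
Qed.

Lemma T_semiregular : semiregular dot T.
Proof.
split; first exact: T_module_operator.
  exact: (boundary_restriction_dense norm_dot D_sym phip_def phim_def T_boundary).
exact: (boundary_restriction_dense norm_dot D_sym phip_def phim_def T_adj_boundary).
Qed.


(** Applied to y = f p this expresses the boundary values of D^* f by the value of
   f + T^* T f, so that a relation between them becomes one on the range. *)
Lemma alpha_range (y : H) : dom Dm y -> dom Dm (Dm y) -> alp y = 0 -> alm y = 0 ->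
  alp (Dm y) = - 'i * ip phip (y + Dm (Dm y)) /\
  alm (Dm y) = 'i * ip phim (y + Dm (Dm y)).
Proof.
move=> yD DyD ap am.
have Dy := dom_alpha norm_dot D_sym D_def phip_def phim_def phip_norm phim_norm yD ap am.
have [_ yE] := hadjoint_ext norm_dot D_sym Dy; rewrite yE in DyD *.
split; first exact: alpha_Dp.
exact: alpha_Dm.
Qed.

(** At a point of ssupp that is not interior, f has boundary values zero while
   those of D^* f have equal absolute values by continuity. Hence the range of
   1 + T^* T satisfies a closed nontrivial condition there. *)
Lemma T_regular_ssupp : regular dot T -> ssupp° = ssupp.
Proof.
move=> [_ _ d]; apply/seteqP; split; first exact: interior_subset.
move=> p sp; apply: contrapT => ip_; have cp := closure_reg ip_.
apply: (mdense_separate (p := p) d) => _ [f [fT TfT] <-].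
have [fT' _] := fT; have [fD _ _] := (domTmaxP norm_dot D_sym f).1 fT'.
have [TfT' _] := (T_adj_dom _).1 TfT.
have [DfD _ _] := (domTmaxP norm_dot D_sym _).1 TfT'.
have [ap am] := T_ssupp fT sp.
have [E1 E2] := alpha_range (fD p) (DfD p) ap am.
have := T_adj_closure TfT cp; rewrite [alp _]E1 [alm _]E2.
rewrite !nrM nrN nr_i !mul1r => E.
have -> : (f + madjoint T (T f)) p = f p + Dm (Dm (f p)) by rewrite (T_adjE TfT).
exact: E.
Qed.

(** When ssupp is clopen the resolvent is explicit: it is (1 + D^* D)^-1 on
   ssupp, corrected on reg by the vector of ker (D^* D^* + 1) that restores the
   boundary condition. *)
Lemma ssupp_T_range : ssupp° = ssupp -> forall g, module g ->
  exists2 f, dom T f /\ dom (madjoint T) (T f) & f + madjoint T (T f) = g.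
Proof.
move=> so g gm; have [gc gv] := (C0P g).1 gm.
have [pD pE] := phip_def; have [mD mE] := phim_def.
pose P x := ip phip (g x); pose M x := ip phim (g x).
(* For f = (1 + D^* D)^-1 g + c phip + b phim, the conditions that both f and
   D^* f have boundary values in the ratio Lambda determine b and c. *)
pose c x : R[i]^o := if x \in reg then 2^-1 * (P x + Lambda x * M x) else 0.
pose b x : R[i]^o := if x \in reg then 2^-1 * (M x + (Lambda x)^* * P x) else 0.
have cont (F : X -> R[i]^o) : (forall x, reg x -> ncont F x) ->
    forall x, ncont (fun x => (if x \in reg then F x else 0) : R[i]^o) x.
  move=> Fc x; have [rx|sx] := pselect (reg x).
    apply: (ncont_near (f := F)); last exact: Fc.
    have := open_nbhs_nbhs (conj (reg_open Lambda) rx).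
    by apply: filterS => q rq; rewrite mem_set.
  apply: (ncont_near (f := fun=> 0)); last exact: ncont_cst.
  have : ssupp° x by rewrite so.
  by apply: filterS => q sq; rewrite memNset.
have Pc x : ncont (P : X -> R[i]^o) x by exact: ncont_ip.
have Mc x : ncont (M : X -> R[i]^o) x by exact: ncont_ip.
have Lc x := reg_ncont (Lambda := Lambda) (p := x).
have cc : forall x, ncont c x.
  apply: cont => x rx; apply: ncontM; first exact: ncont_cst.
  by apply: (ncontD (V := R[i]^o)) => //; apply: ncontM => //; exact: Lc.
have bc : forall x, ncont b x.
  apply: cont => x rx; apply: ncontM; first exact: ncont_cst.
  apply: (ncontD (V := R[i]^o)) => //; apply: ncontM => //; apply: ncont_conj; exact: Lc.
pose C := nr phip + nr phim + 1.
have C0 : 0 < C by rewrite ltr_wpDl// addr_ge0// nr_ge0.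
have half (z : R[i]) x : nr z = 1 ->
    nr (2^-1 * (P x + z * M x)) <= C * nr (g x) /\
    nr (2^-1 * (M x + z * P x)) <= C * nr (g x).
  move=> z1; have h2 : nr (2^-1 : R[i]) = 2^-1.
    apply: nr_eqE; rewrite ger0_norm ?invr_ge0 ?ler0n//.
    by rewrite fmorphV/= rmorph_nat.
  have p1 := cauchy_schwarz norm_dot phip (g x); have m1 := cauchy_schwarz norm_dot phim (g x).
  have g0 := nr_ge0 (g x); have P0 := nr_ge0 (P x); have M0 := nr_ge0 (M x).
  have s1 := nrD (P x) (z * M x); have s2 := nrD (M x) (z * P x).
  rewrite -/(P x) in p1; rewrite -/(M x) in m1.
  rewrite !nrM z1 h2 !mul1r in s1 s2 *; rewrite /C !mulrDl mul1r.
  by split; lra.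
have L1 x : nr (Lambda x) = 1 by apply: nr_eqE; exact: Lambda_S1.
have cg x : nr (c x) <= C * nr (g x).
  rewrite /c; case: ifP => _; first exact: (half _ x (L1 x)).1.
  by rewrite nr0 mulr_ge0 ?nr_ge0// ltW.
have bg x : nr (b x) <= C * nr (g x).
  rewrite /b; case: ifP => _; last by rewrite nr0 mulr_ge0 ?nr_ge0// ltW.
  by apply: (half _ x _).2; rewrite nr_conj.
have cb x : c x = Lambda x * b x.
  rewrite /c /b; case: ifP => _; last by rewrite mulr0.
  rewrite mulrCA; congr (_ * _).
  have -> : Lambda x * (M x + (Lambda x)^* * P x) =
    Lambda x * M x + ((Lambda x)^* * Lambda x) * P x by ring.
  by rewrite Lambda_conj mul1r addrC.
have bnd x : reg x -> - 'i * P x + 'i * c x = Lambda x * ('i * M x - 'i * b x).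
  move=> rx; rewrite mulrBr [Lambda x * ('i * b x)]mulrCA -cb /c mem_set//.
  by field.
pose A := resolvent norm_dot D_sym.
have AP y := resolventP norm_dot D_sym y; rewrite -/A in AP.
have [A0 DA0] := resolvent0 norm_dot D_sym; rewrite -/A in A0 DA0.
have lipA y z := resolvent_lipschitz norm_dot D_sym y z; rewrite -/A in lipA.
pose f : {uniform X -> H} := fun x => A (g x) + (c x *: phip + b x *: phim).
have comb u v : dom Dm (u *: phip + v *: phim) /\
    Dm (u *: phip + v *: phim) = (u * 'i) *: phip + (v * - 'i) *: phim.
  have [D1 E1] := linear_domZ Dmlin u pD; have [D2 E2] := linear_domZ Dmlin v mD.
  by have [D3 E3] := linear_domD Dmlin D1 D2; rewrite E3 E1 E2 pE mE !scalerA.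
have alpha_comb u v : alp (u *: phip + v *: phim) = u /\ alm (u *: phip + v *: phim) = v.
  have [D1 _] := linear_domZ Dmlin u pD; have [D2 _] := linear_domZ Dmlin v mD.
  rewrite !(graph_ipD norm_dot D_sym)// !(graph_ipZ norm_dot D_sym)//.
  rewrite (alp_phip phip_norm) (alp_phim phip_def phim_def).
  rewrite (alm_phim phim_norm) (alm_phip phip_def phim_def).
  by rewrite !mulr1 !mulr0 addr0 add0r.
have fP x : dom Dm (f x) /\
    Dm (f x) = D (A (g x)) + ((c x * 'i) *: phip + (b x * - 'i) *: phim).
  have [a1 _ _] := AP (g x); have [a2 a3] := hadjoint_ext norm_dot D_sym a1.
  have [k1 k2] := comb (c x) (b x).
  by have [l1 l2] := linear_domD Dmlin a2 k1; rewrite l2 a3 k2.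
have DfP x : dom Dm (Dm (f x)) /\ Dm (Dm (f x)) = g x - f x.
  have [_ ->] := fP x; have [_ a2 a3] := AP (g x).
  have [k1 k2] := comb (c x * 'i) (b x * - 'i).
  have [l1 l2] := linear_domD Dmlin a2 k1; split=> //; rewrite l2 k2.
  rewrite -!mulrA mulrNN ii !mulrN1 !scaleNr -opprD /f.
  move: a3; set y := A (g x) => a3.
  by rewrite -a3 [y + Dm _]addrC [- (y + _)]opprD [RHS]addrA addrK.
have fm : module f.
  apply: C0_D; first by apply: (C0_lip ltr01 (A := A) _ A0 gm) => y z;
    rewrite mul1r; exact: (lipA y z).1.
  by apply: C0_D; [exact: (C0_scal _ C0 cc cg gv)|exact: (C0_scal _ C0 bc bg gv)].
have Dfm : module (fun x => Dm (f x)).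
  rewrite (_ : (fun x => _) = fun x => D (A (g x)) +
     (c x *: ('i *: phip) + b x *: (- 'i *: phim))); last first.
    by apply/funext => x; have [_ ->] := fP x; rewrite !scalerA.
  apply: C0_D; first by apply: (C0_lip ltr01 (A := fun y => D (A y)) _ DA0 gm) => y z;
    rewrite mul1r; exact: (lipA y z).2.
  by apply: C0_D; [exact: (C0_scal _ C0 cc cg gv)|exact: (C0_scal _ C0 bc bg gv)].
have fT : dom TM f.
  by apply/(domTmaxP norm_dot D_sym); split => // x; have [] := fP x.
have DfT : dom TM (TM f).
  apply/(domTmaxP norm_dot D_sym); split => [x|//|]; first by have [] := DfP x.
  rewrite (_ : (fun x => _) = fun x => g x + (-1) *: f x).
    apply: C0_D => //; apply: (C0_lip ltr01 (A := fun y => -1 *: y)) fm.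
      by move=> y z; rewrite -scalerBr scaleN1r nrN mul1r.
    by rewrite scaler0.
  by apply/funext => x; have [_ ->] := DfP x; rewrite scaleN1r.
have af x : alp (f x) = c x /\ alm (f x) = b x.
  have [a1 _ _] := AP (g x); have [a2 _] := hadjoint_ext norm_dot D_sym a1.
  have [k1 _] := comb (c x) (b x).
  rewrite (graph_ipD norm_dot D_sym phip a2 k1) (graph_ipD norm_dot D_sym phim a2 k1).
  have [-> ->] := alpha_comb (c x) (b x).
  have [-> ->] := alpha_dom norm_dot D_sym phip_def phim_def a1.
  by rewrite !add0r.
have aDf x : alp (Dm (f x)) = - 'i * P x + 'i * c x /\
    alm (Dm (f x)) = 'i * M x - 'i * b x.
  have [_ ->] := fP x; have [a1 a2 a3] := AP (g x).
  have [k1 _] := comb (c x * 'i) (b x * - 'i).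
  rewrite (graph_ipD norm_dot D_sym phip a2 k1) (graph_ipD norm_dot D_sym phim a2 k1).
  have [-> ->] := alpha_comb (c x * 'i) (b x * - 'i).
  rewrite (alpha_Dp norm_dot D_sym phip_def a1 a2) (alpha_Dm norm_dot D_sym phim_def a1 a2) a3.
  by rewrite mulrN ![_ * 'i]mulrC.
have fS : dom T f.
  by split => // x; have [-> ->] := af x.
have TfS : dom (madjoint T) (T f).
  by apply/T_adj_dom; split => // x rx; have [E1 E2] := aDf x; rewrite [alp _]E1 [alm _]E2 bnd.
exists f => //; apply/funext => x.
have -> : (f + madjoint T (T f)) x = f x + Dm (Dm (f x)) by rewrite (T_adjE TfS).
by have [_ ->] := DfP x; rewrite addrC subrK.
Qed.

Lemma ssupp_T_regular : ssupp° = ssupp -> regular dot T.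
Proof.
move=> so; split; [exact: T_closed|exact: T_semiregular|].
move=> g gm; apply: subset_closure.
by have [f fS E] := ssupp_T_range so gm; exists f.
Qed.

(** alpha_+ / alpha_- is the continuous extension of Lambda. *)
Lemma quotient_reg_oo f p : closure reg = setT -> dom (madjoint T) f ->
  ssupp p -> alm (f p) != 0 -> reg_oo Lambda p.
Proof.
move=> cr fS sp mp; have [fT fL] := (T_adj_dom f).1 fS.
have cont q := ncont_alpha norm_dot D_sym phip phim q fT.
pose U := [set q | alm (f q) != 0].
have oU : open U.
  rewrite openE => q Uq; have [_ c] := cont q.
  exact: (ncont_neq0 (V := R[i]^o) c).
split.
  by split=> [|/interior_subset rp]; [rewrite cr|exact: sp].
exists U, (fun x => alp (f x) * (alm (f x))^-1 : R[i]^o); split.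
- by split.
- apply/(within_ncont _ oU) => q Uq; have [c1 c2] := cont q.
  by apply: ncontM => //; exact: ncontV.
- move=> q Uq; have qr : closure reg q by rewrite cr.
  rewrite normrM normfV nrE (T_adj_closure fS qr) -nrE divff//.
  by rewrite normr_eq0.
- by move=> q Uq rq; rewrite fL// mulfK.
Qed.

Lemma interior_ssupp_bump p : ssupp° p -> exists2 f, dom (madjoint T) f &
  alp (f p) = 0 /\ alm (f p) = 1.
Proof.
move=> ip_.
have [f [chi [fT chi1 chi0 fp fm]]] := bump_phi norm_dot D_sym phip_def
    phim_def phip_norm phim_norm lcX T2X (@open_interior _ ssupp) ip_
    (a := fun=> 0) (b := fun=> 1) (fun q _ => ncont_cst _ _) (fun q _ => ncont_cst _ _).
exists f; last by rewrite fp fm chi1 mulr0 mulr1.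
apply/T_adj_dom; split => // x rx; rewrite fp fm chi0 ?mul0r ?mulr0//.
by move=> /interior_subset; exact.
Qed.

(** A function whose boundary value alpha_- is 1 at a point of ssupp cannot be in
   dom T; but it can be found in the domain of the adjoint near an interior
   point of ssupp, and near a point of reg_oo by means of the extension of
   Lambda. *)
Lemma T_selfadjoint_ssupp : selfadjoint dot T -> ssupp = ssupp_r Lambda.
Proof.
move=> [_ [dT _]].
have nint p : ~ ssupp° p.
  move=> ip_; have [f fS [_ f1]] := interior_ssupp_bump ip_.
  rewrite -dT in fS; have [_ ] := T_ssupp fS (interior_subset ip_).
  by rewrite f1 => /eqP; rewrite oner_eq0.
apply/seteqP; split=> p.
  move=> sp; split; first by split; [exact: subset_closure|exact: nint].
  move=> [_ [U [L [[oU Up] cL _ LL]]]]; have {}cL := (within_ncont L oU).1 cL.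
  have [f [chi [fT chi1 chi0 fp fm]]] := bump_phi norm_dot D_sym phip_def
    phim_def phip_norm phim_norm lcX T2X oU Up
    (a := L) (b := fun=> 1) cL (fun q _ => ncont_cst _ _).
  have fS : dom (madjoint T) f.
    apply/T_adj_dom; split => // x rx; rewrite fp fm.
    have [Ux|Ux] := pselect (U x); first by rewrite LL// mulr1 mulrC.
    by rewrite chi0// !mul0r mulr0.
  rewrite -dT in fS; have [_ ] := T_ssupp fS sp.
  by rewrite fm chi1 mulr1 => /eqP; rewrite oner_eq0.
by move=> [[cp _] _]; apply: (@ssupp_closed _ _ Lambda); exact: cp.
Qed.

(** As reg is dense, an element of the domain of the adjoint with a nonzero
   boundary value at a point of ssupp would put this point in reg_oo. *)
Lemma ssupp_T_selfadjoint : ssupp = ssupp_r Lambda -> selfadjoint dot T.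
Proof.
move=> sr; split; first exact: T_semiregular.
have cr : closure reg = setT.
  rewrite -subTset => p _; apply: closure_reg => ip_.
  have : ssupp p := interior_subset ip_.
  by rewrite sr => -[[_ /(_ ip_)]].
split; last by move=> f fS; rewrite T_adjE//; exact: T_sub_adj.
apply/seteqP; split=> f; first exact: T_sub_adj.
move=> fS; have [fT fL] := (T_adj_dom f).1 fS; split => // x.
have [rx|sx] := pselect (reg x); first exact: fL.
have [m0|m0] := eqVneq (alm (f x)) 0; last first.
  have := quotient_reg_oo cr fS sx m0.
  by have : ssupp x := sx; rewrite sr => -[_ nx] /nx.
rewrite m0 mulr0; apply: nr_eq0.
by rewrite (T_adj_closure fS) ?m0 ?nr0// cr.
Qed.

Lemma continuous_selfadjoint_regular : continuous Lambda ->
  selfadjoint dot T /\ regular dot T.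
Proof.
move=> /continuous_ssupp s0; split.
  apply: ssupp_T_selfadjoint; apply/seteqP; split=> p; first by rewrite s0.
  by move=> [[+ _] _]; rewrite s0 closure0.
by apply: ssupp_T_regular; rewrite s0 interior0.
Qed.

(** Selfadjointness of the adjoint excludes interior points of ssupp, where its
   elements have arbitrary boundary values. At a point of ssupp outside of
   reg_oo all its elements have boundary values zero, hence so does D^* f for f
   in the domain of its square, which contradicts the density of the range. *)
Lemma adjoint_reg_oo : selfadjoint dot (madjoint T) -> regular dot (madjoint T) ->
  ssupp = reg_oo Lambda.
Proof.
move=> [_ [dT _]] [_ _ d].
have bT := T_adj_boundary.
have nint p : ~ ssupp° p.
  move=> ip_; have [f fS [f0 f1]] := interior_ssupp_bump ip_.
  have fS' := fS; rewrite dT in fS'.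
  have := ((madjointP norm_dot D_sym D_def phip_def phim_def phip_norm phim_norm
     lcX T2X f bT).1 fS').2 f fS p.
  by rewrite f0 f1 mulr0 mulr1 rmorph1 => /eqP; rewrite eq_sym oner_eq0.
have cr : closure reg = setT.
  by rewrite -subTset => p _; apply: closure_reg; exact: nint.
apply/seteqP; split=> [p sp|p /reg_oo_reg[]//].
apply: contrapT => np.
have am0 f : dom (madjoint T) f -> alm (f p) = 0.
  move=> fS; apply: contrapT => /eqP m0; apply: np; exact: quotient_reg_oo fS _ _.
have ap0 f : dom (madjoint T) f -> alp (f p) = 0.
  move=> fS; apply: nr_eq0; rewrite (T_adj_closure fS) ?cr//.
  by rewrite am0// nr0.
apply: (mdense_separate (p := p) d) => _ [f [fS TfS] <-].
have TfE := T_adjE fS.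
have E : madjoint (madjoint T) (madjoint T f) = TM (madjoint T f).
  exact: (madjointE norm_dot D_sym phip_def phim_def lcX T2X bT TfS).
rewrite -dT TfE in TfS.
have -> : (f + madjoint (madjoint T) (madjoint T f)) p = f p + Dm (Dm (f p)).
  by rewrite E TfE.
have [fD _ _] := (domTmaxP norm_dot D_sym f).1 ((T_adj_dom f).1 fS).1.
have [DfD _ _] := (domTmaxP norm_dot D_sym _).1 ((T_adj_dom _).1 TfS).1.
have [E1 E2] := alpha_range (fD p) (DfD p) (ap0 _ fS) (am0 _ fS).
have := ap0 _ TfS; have := am0 _ TfS; rewrite [alp _]E1 [alm _]E2.
move=> /(congr1 (@nr R _)) m0 /(congr1 (@nr R _)) p0; move: m0 p0.
by rewrite !nrM nrN nr_i !mul1r nr0 => -> ->.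
Qed.

End WithLambda.

Section LambdaTilde.
Context (Lambda : X -> R[i]^o) (Lambda_S1 : forall x, `|Lambda x| = 1).
Local Notation T := (TLambda dot D phip phim Lambda).
Hypothesis ssupp_reg_oo : ssupp Lambda = reg_oo Lambda.

(** With dense regular set, the adjoint of T_Lambda only sees the continuous
   extension of Lambda. *)
Lemma T_adj_tilde : selfadjoint dot (madjoint T) /\ regular dot (madjoint T).
Proof.
have tc := Lambda_tilde_continuous ssupp_reg_oo.
have cr p : closure (reg Lambda) p.
  have [rp|sp] := pselect (reg Lambda p); first exact: subset_closure.
  by have [] : closure (reg Lambda) p /\ ssupp Lambda p;
    first by apply: reg_oo_reg; rewrite -ssupp_reg_oo.
have t1 x : `|Lambda_tilde Lambda x| = 1.
  have [rx|sx] := pselect (reg Lambda x); first by rewrite Lambda_tilde_reg.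
  have /(ncontP (V := R[i]^o)) c := tc x.
  have : reg_oo Lambda x by rewrite -ssupp_reg_oo.
  move=> [_ [U [L [[oU Ux] cL L1 LL]]]].
  suff -> : Lambda_tilde Lambda x = L x by exact: L1.
  have /(within_ncont _ oU)/(_ x Ux) cLx := cL.
  apply: (ncont_closure_eq (S := U `&` reg Lambda) (V := R[i]^o)) cLx _ _ => //.
    by move=> q [Uq rq]; rewrite Lambda_tilde_reg// LL.
  move=> B Bx; have [q [rq [Uq Bq]]] := cr x _ (filterI (open_nbhs_nbhs (conj oU Ux)) Bx).
  by exists q.
pose Tt := TLambda dot D phip phim (Lambda_tilde Lambda).
have [sT rT] := continuous_selfadjoint_regular t1 tc.
have dE : dom (madjoint T) = dom Tt.
  apply/seteqP; split=> f.
    move=> /(T_adj_dom Lambda_S1)[fT fL]; split => // x.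
    have [c1 c2] := ncont_alpha norm_dot D_sym phip phim x fT.
    have /(ncontP (V := R[i]^o)) ct := tc x.
    apply: (ncont_closure_eq (S := reg Lambda) (V := R[i]^o)
      (f := fun x => alp (f x)) (g := fun x => Lambda_tilde Lambda x * alm (f x))) => //.
      exact: ncontM.
    by move=> q rq; rewrite Lambda_tilde_reg// fL.
  move=> [fT fL]; apply/(T_adj_dom Lambda_S1); split => // x rx.
  by rewrite fL Lambda_tilde_reg.
have E : op_eq (madjoint T) Tt.
  by split=> // f fS; rewrite T_adjE// dE.
by split; [exact: selfadjoint_op_eq E sT|exact: regular_op_eq E rT].
Qed.
End LambdaTilde.
End TLambdaFacts.

(** * Regularity and selfadjointness *)

Theorem proposition6p3 (R : realType) (H : completeNormedModType R[i])
    (dot : {dot H for Num.conj}) (norm_dot : forall x, `|x| ^+ 2 = dot x x)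
    (separable_H : separable H)
    (D : operator H) (D_sym : closed_symmetric dot D)
    (D_def : deficiency_indices dot D 1 1)
    (phip phim : H)
    (phip_def : deficiency_space dot D 'i phip)
    (phim_def : deficiency_space dot D (- 'i) phim)
    (phip_norm : graph_norm dot (hadjoint dot D) phip = 1)
    (phim_norm : graph_norm dot (hadjoint dot D) phim = 1)
    (X : topologicalType) (lcX : locally_compact [set: X])
    (T2X : hausdorff_space X)
    (Lambda : X -> R[i]^o) (Lambda_S1 : forall x, `|Lambda x| = 1)
    (Lambda_borel : borel Lambda) :
  let T := TLambda dot D phip phim Lambda in
  let T' := madjoint dot T in
  [/\ regular dot T <-> (ssupp Lambda)° = ssupp Lambda,
      selfadjoint dot T <-> ssupp Lambda = ssupp_r Lambda,
      (selfadjoint dot T /\ regular dot T <-> continuous Lambda) /\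
      (continuous Lambda <-> ssupp Lambda = set0) &
      (selfadjoint dot T' /\ regular dot T' <->
        reg Lambda `|` reg_oo Lambda = setT /\
        continuous (Lambda_tilde Lambda)) /\
      (reg Lambda `|` reg_oo Lambda = setT /\
        continuous (Lambda_tilde Lambda) <->
        ssupp Lambda = reg_oo Lambda)].
Proof.
move=> T T'.
have rT : regular dot T <-> (ssupp Lambda)° = ssupp Lambda.
  by split; [exact: T_regular_ssupp|exact: ssupp_T_regular].
have sT : selfadjoint dot T <-> ssupp Lambda = ssupp_r Lambda.
  by split; [exact: T_selfadjoint_ssupp|exact: ssupp_T_selfadjoint].
have srT : reg Lambda `|` reg_oo Lambda = setT /\
    continuous (Lambda_tilde Lambda) <-> ssupp Lambda = reg_oo Lambda.
  split=> [[U _]|E]; last first.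
    split; last exact: Lambda_tilde_continuous.
    by rewrite -E; exact: setUCr.
  apply/seteqP; split=> p; last by case/reg_oo_reg.
  by move=> np; have : setT p by []; rewrite -U => -[].
split => //; split => //; [split| |]; last by rewrite srT; split=> [[]|];
  [exact: adjoint_reg_oo|exact: T_adj_tilde].
- move=> [/sT E /rT so]; apply/continuous_ssupp; rewrite -subset0 => p sp.
  have : ssupp_r Lambda p by rewrite -E.
  by case=> -[_ +] _; apply; rewrite so.
- exact: continuous_selfadjoint_regular.
- exact: continuous_ssupp.
Qed.
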